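(* Let $(\mathfrak{J},\mathfrak{M})$ be a $\mathfrak{J}$-ternary superalgebra with operations $\cdot,\bullet,\star$ and triple product $(-,-,-)$. Then the vector superspace $$\mathfrak{g}(\mathfrak{J},\mathfrak{M})=\mathfrak{sl}_2\otimes\mathfrak{J}\ \oplus\ V\otimes\mathfrak{M}\ \oplus\ \mathrm{InnDer}(\mathfrak{J},\mathfrak{M})$$ is a short $\mathfrak{sl}_2$-Lie superalgebra, where $\mathfrak{sl}_2$ acts through the first tensor factors and trivially on $\mathrm{InnDer}(\mathfrak{J},\mathfrak{M})$, and the (super-anticommutative) bracket is given by the supercommutator on $\mathrm{InnDer}(\mathfrak{J},\mathfrak{M})$ together with $$[d,x\otimes a]=x\otimes d(a),\qquad [d,v\otimes m]=v\otimes d(m),\qquad [x\otimes a,y\otimes b]=[x,y]\otimes a\cdot b+\tfrac12\kappa(x,y)\langle a,b\rangle,$$ $$[x\otimes a,v\otimes m]=x(v)\otimes a\bullet m,\qquad [v\otimes m,w\otimes n]=(v\odot w)\otimes m\star n+\det(v,w)\,\partial_{m,n}$$ for $d\in\mathrm{InnDer}(\mathfrak{J},\mathfrak{M})$, $x,y\in\mathfrak{sl}_2$, $v,w\in V$, $a,b\in\mathfrak{J}$, $m,n\in\mathfrak{M}$.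
   Context: Everything is over $\mathbb{C}$; superspaces are $\mathbb{Z}_2$-graded. $\mathfrak{sl}_2=\mathfrak{sl}_2(\mathbb{C})$ has standard basis $e,f,h$; $V=\mathbb{C}e_1\oplus\mathbb{C}e_2$ is its natural representation; both have even degree. $\kappa(x,y)=4\,\mathrm{tr}(xy)$; $\det:V\otimes V\to\mathbb{C}$ is the determinant form; $\odot:V\otimes V\to\mathfrak{sl}_2$ is bilinear with $e_1\odot e_1=e$, $e_1\odot e_2=e_2\odot e_1=-\tfrac12h$, $e_2\odot e_2=-f$. A short $\mathfrak{sl}_2$-Lie superalgebra is a Lie superalgebra on which $\mathfrak{sl}_2$ acts by even derivations and which as $\mathfrak{sl}_2$-module is of the form $\mathfrak{sl}_2\otimes\mathfrak{J}\oplus V\otimes\mathfrak{M}\oplus\mathfrak{D}$ with $\mathfrak{J},\mathfrak{M},\mathfrak{D}$ superspaces with trivial $\mathfrak{sl}_2$-action. A Jordan superalgebra is a superspace $\mathfrak{J}$ with an even product satisfying $a\cdot b=(-1)^{|a||b|}b\cdot a$ and $(a\cdot b)\cdot(c\cdot d)+(-1)^{|b||c|}(a\cdot c)\cdot(b\cdot d)+(-1)^{|b||d|+|c||d|}(a\cdot d)\cdot(b\cdot c)=((a\cdot b)\cdot c)\cdot d+(-1)^{|b||c|+|b||d|+|c||d|}((a\cdot d)\cdot c)\cdot b+(-1)^{|a||b|+|a||c|+|a||d|+|c||d|}((b\cdot d)\cdot c)\cdot a$. A special $\mathfrak{J}$-supermodule is a superspace $\mathfrak{M}$ with an even bilinear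 $\bullet:\mathfrak{J}\otimes\mathfrak{M}\to\mathfrak{M}$ such that $(a\cdot b)\bullet m=\tfrac12(a\bullet(b\bullet m)+(-1)^{|a||b|}b\bullet(a\bullet m))$. A $\mathfrak{J}$-ternary superalgebra $(\mathfrak{J},\mathfrak{M})$ consists of a Jordan superalgebra $(\mathfrak{J},\cdot)$, a special $\mathfrak{J}$-supermodule $(\mathfrak{M},\bullet)$, an even super-anticommutative bilinear map $\star:\mathfrak{M}\otimes\mathfrak{M}\to\mathfrak{J}$ ($m\star n=-(-1)^{|m||n|}n\star m$) and an even trilinear product $(-,-,-):\mathfrak{M}^{\otimes3}\to\mathfrak{M}$ such that for all homogeneous $a\in\mathfrak{J}$, $m,n,r,s,t\in\mathfrak{M}$: (SJT1) $a\cdot(m\star n)=\tfrac12((a\bullet m)\star n+(-1)^{|a||m|}m\star(a\bullet n))$; (SJT2) $a\bullet(m,n,s)=(a\bullet m,n,s)-(-1)^{|a||m|}(m,a\bullet n,s)+(-1)^{|a|(|m|+|n|)}(m,n,a\bullet s)$; (SJT3) $(m,n,s)=(-1)^{|m|(|n|+|s|)+|n||s|}(s,n,m)-(-1)^{|n||s|}(m\star s)\bullet n$; (SJT4) $(m,n,s)=(-1)^{|m||n|}(n,m,s)+(m\star n)\bullet s$; (SJT5) $(m,n,r)\star s+(-1)^{|r|(|m|+|n|)}r\star(m,n,s)=(-1)^{|n|(|r|+|s|)}m\star((r\star s)\bullet n)$; (SJT6) $(m,n,(r,s,t))=((m,n,r),s,t)+(-1)^{|r|(|m|+|n|)+|m||n|}(r,(n,m,s),t)+(-1)^{(|m|+|n|)(|r|+|s|)}(r,s,(m,n,t))$.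 For homogeneous $a,b,c\in\mathfrak{J}$, $m,n,r\in\mathfrak{M}$, the endomorphisms $\langle a,b\rangle,\partial_{m,n}\in\mathrm{End}(\mathfrak{J}\oplus\mathfrak{M})$ are defined by $\langle a,b\rangle(c)=a\cdot(b\cdot c)-(-1)^{|a||b|}b\cdot(a\cdot c)$, $\langle a,b\rangle(m)=\tfrac14(a\bullet(b\bullet m)-(-1)^{|a||b|}b\bullet(a\bullet m))$, $\partial_{m,n}(a)=\tfrac12((-1)^{|a|(|m|+|n|)}(a\bullet m)\star n-(-1)^{|a||n|}m\star(a\bullet n))$, $\partial_{m,n}(r)=\tfrac12(m\star n)\bullet r-(m,n,r)$. $\mathrm{InnDer}(\mathfrak{J},\mathfrak{M})\subseteq\mathrm{End}(\mathfrak{J}\oplus\mathfrak{M})$ is the linear span of all $\langle a,b\rangle$ and $\partial_{m,n}$; it is closed under the supercommutator. *)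

(* Defs.v *)
From HB Require Import structures.
From mathcomp Require Import all_boot all_order all_algebra.
From mathcomp Require Export complex.
From mathcomp Require Import boolp classical_sets functions.
From mathcomp Require Export reals.

Set Implicit Arguments.
Unset Strict Implicit.
Unset Printing Implicit Defensive.

Import GRing.Theory.
Local Open Scope ring_scope.

(* Z_2 is bool, with false = even.  A sign (-1)^{|a||b|+|c|} with |a| = i,
   |b| = j, |c| = k is written (-1) ^+ (i * j + k), the parities being coerced
   to nat. *)

Definition subspace (F : fieldType) (V : lmodType F) (S : set V) : Prop :=
  S 0 /\ forall (c : F) u v, S u -> S v -> S (c *: u + v).

Definition lspan (F : fieldType) (V : lmodType F) (G : set V) : set V :=
  smallest (@subspace F V) G.

Definition bilinear_map (F : fieldType) (U V W : lmodType F)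
    (f : U -> V -> W) : Prop :=
  (forall u, linear (f u)) /\ (forall v, linear (f^~ v)).

Section Linear.
Variables (F : fieldType) (U V W : lmodType F).

Lemma linear_comp (f : V -> W) (g : U -> V) :
  linear f -> linear g -> linear (fun x => f (g x)).
Proof. by move=> lf lg c x y; rewrite lg lf. Qed.

Lemma linear_sub (f g : U -> V) :
  linear f -> linear g -> linear (fun x => f x - g x).
Proof. by move=> lf lg c x y; rewrite lf lg opprD addrACA scalerBr. Qed.

Lemma linear_scale (k : F) (f : U -> V) : linear f -> linear (fun x => k *: f x).
Proof. by move=> lf c x y; rewrite lf scalerDr !scalerA mulrC. Qed.

Lemma linear_sum (I : finType) (f : I -> U -> V) :
  (forall i, linear (f i)) -> linear (fun x => \sum_i f i x).
Proof.
move=> lf c x y; rewrite scaler_sumr -big_split.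
by apply: eq_bigr => i _; rewrite lf.
Qed.

Lemma linear_pair (f : U -> V) (g : U -> W) :
  linear f -> linear g -> linear (fun x => (f x, g x) : (V * W)%type).
Proof. by move=> lf lg c x y; rewrite lf lg. Qed.

Lemma linear_eq0 (f : U -> V) : linear f -> f 0 = 0.
Proof.
by move=> lf; have := lf (-1) 0 0; rewrite scaler0 addr0 scaleN1r addNr.
Qed.

Lemma linear_add (f : U -> V) : linear f -> {morph f : x y / x + y}.
Proof. by move=> lf x y; have := lf 1 x y; rewrite !scale1r. Qed.

End Linear.

Record superspace (F : fieldType) := Superspace {
  svect :> lmodType F;
  hdeg : bool -> set svect;
  hdeg_subspace : forall i, subspace (hdeg i);
  hdeg_decomp : forall v, exists v0 v1,
    [/\ hdeg false v0, hdeg true v1 & v = v0 + v1];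
  hdeg_inter : forall v, hdeg false v -> hdeg true v -> v = 0
}.
Arguments hdeg {F s} i v.

Definition hcomp (F : fieldType) (V : superspace F) (i : bool) (v : V) : V :=
  xget 0 [set u | hdeg i u /\ hdeg (~~ i) (v - u)].

Lemma hdegD (F : fieldType) (V : superspace F) i (u v : V) :
  hdeg i u -> hdeg i v -> hdeg i (u + v).
Proof.
by move=> hu hv; rewrite -[u]scale1r; apply: (hdeg_subspace V i).2.
Qed.

Lemma hdegZ (F : fieldType) (V : superspace F) i (c : F) (v : V) :
  hdeg i v -> hdeg i (c *: v).
Proof.
have [h0 hl] := hdeg_subspace V i.
by move=> hv; rewrite -[c *: v]addr0; apply: hl.
Qed.

Lemma hdeg0 (F : fieldType) (V : superspace F) i : hdeg i (0 : V).
Proof. exact: (hdeg_subspace V i).1. Qed.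

Lemma hdegB (F : fieldType) (V : superspace F) i (u v : V) :
  hdeg i u -> hdeg i v -> hdeg i (u - v).
Proof. by move=> hu hv; rewrite -scaleN1r; apply/hdegD/hdegZ. Qed.

Lemma hdeg_sum (F : fieldType) (V : superspace F) i (I : finType) (f : I -> V) :
  (forall k, hdeg i (f k)) -> hdeg i (\sum_k f k).
Proof.
by move=> hf; apply: (big_ind (hdeg i)) => //; [exact: hdeg0|exact: hdegD].
Qed.

Lemma hdeg_disj (F : fieldType) (V : superspace F) i (v : V) :
  hdeg i v -> hdeg (~~ i) v -> v = 0.
Proof. by case: i => /= h h'; apply: hdeg_inter. Qed.

Lemma hcompP (F : fieldType) (V : superspace F) i (v : V) :
  hdeg i (hcomp i v) /\ hdeg (~~ i) (v - hcomp i v).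
Proof.
have ex : exists u, hdeg i u /\ hdeg (~~ i) (v - u).
  have [v0 [v1 [h0 h1 ->]]] := hdeg_decomp v.
  case: i; first by exists v1; rewrite addrK.
  by exists v0; rewrite [v0 + v1]addrC addrK.
exact: xgetPex ex.
Qed.

Lemma hcompE (F : fieldType) (V : superspace F) i (u v : V) :
  hdeg i u -> hdeg (~~ i) (v - u) -> hcomp i v = u.
Proof.
move=> hu hvu; have [h1 h2] := hcompP i v; apply/eqP; rewrite -subr_eq0.
apply/eqP/(hdeg_disj (i := i)); first exact: hdegB.
have -> : hcomp i v - u = (v - u) - (v - hcomp i v).
  by rewrite opprB [RHS]addrC addrA subrK.
exact: hdegB.
Qed.

Lemma hcomp_hdeg (F : fieldType) (V : superspace F) i j (v : V) :
  hdeg j v -> hcomp i v = if i == j then v else 0.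
Proof.
move=> hv; case: eqP => [->|/eqP nij]; apply: hcompE => //; rewrite ?subrr ?subr0.
- exact: hdeg0.
- exact: hdeg0.
- by move: nij hv; case: i; case: j.
Qed.

Lemma hdeg_hcomp (F : fieldType) (V : superspace F) i j (v : V) :
  hdeg j v -> hdeg j (hcomp i v).
Proof.
by move=> hv; rewrite (hcomp_hdeg i hv); case: eqP => // _; apply: hdeg0.
Qed.

Lemma hcomp_sum (F : fieldType) (V : superspace F) (v : V) :
  v = hcomp false v + hcomp true v.
Proof.
have [h1 h2] := hcompP false v.
have -> : hcomp true v = v - hcomp false v.
  by apply: hcompE => //; rewrite opprB [v + _]addrC subrK.
by rewrite addrC subrK.
Qed.

Lemma hcomp_linear (F : fieldType) (V : superspace F) i :
  linear (@hcomp F V i).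
Proof.
move=> c u v; have [hu hu'] := hcompP i u; have [hv hv'] := hcompP i v.
apply: hcompE; first exact/hdegD/hv/hdegZ.
by rewrite opprD addrACA -scalerBr; apply/hdegD/hv'/hdegZ.
Qed.

Section DirectSum.
Variables (F : fieldType) (V W : superspace F).

Definition dsum_hdeg (i : bool) : set (V * W)%type :=
  [set z | hdeg i z.1 /\ hdeg i z.2].

Lemma dsum_subspace i : subspace (dsum_hdeg i).
Proof.
split; first by split; apply: hdeg0.
by move=> c u v [hu1 hu2] [hv1 hv2]; split; apply/hdegD => //; apply: hdegZ.
Qed.

Lemma dsum_decomp z : exists z0 z1,
  [/\ dsum_hdeg false z0, dsum_hdeg true z1 & z = z0 + z1].
Proof.
have [v0 [v1 [h0 h1 e1]]] := hdeg_decomp z.1.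
have [w0 [w1 [k0 k1 e2]]] := hdeg_decomp z.2.
exists (v0, w0), (v1, w1); split => //.
by rewrite [LHS]surjective_pairing e1 e2.
Qed.

Lemma dsum_inter z : dsum_hdeg false z -> dsum_hdeg true z -> z = 0.
Proof.
case: z => v w [/= h1 h2] [/= k1 k2].
by rewrite (hdeg_inter h1 k1) (hdeg_inter h2 k2).
Qed.

Definition dsum : superspace F :=
  Superspace dsum_subspace dsum_decomp dsum_inter.

End DirectSum.

Section Tensor.
Variables (F : fieldType) (U : vectType F) (W : superspace F).

Local Notation n := (\dim {: U}).
Local Notation b := (vbasis {: U}).

(* U (x) W is modelled as W^(dim U) through a basis b of U, the family t
   standing for the sum of the b_k (x) t_k; tens_universal is its universal
   property. *)
Definition tens_vect : lmodType F := {ffun 'I_n -> W}.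

Definition tens_hdeg (i : bool) : set tens_vect :=
  [set t : {ffun 'I_n -> W} | forall k, hdeg i (t k)].

Lemma tens_subspace i : subspace (tens_hdeg i).
Proof.
split; first by move=> k; rewrite ffunE; apply: hdeg0.
by move=> c u v hu hv k; rewrite !ffunE; apply/hdegD => //; apply: hdegZ.
Qed.

Lemma tens_decomp t : exists t0 t1,
  [/\ tens_hdeg false t0, tens_hdeg true t1 & t = t0 + t1].
Proof.
exists [ffun k => hcomp false ((t : {ffun 'I_n -> W}) k)].
exists [ffun k => hcomp true ((t : {ffun 'I_n -> W}) k)]; split.
- by move=> k; rewrite ffunE; have [] := hcompP false (t k).
- by move=> k; rewrite ffunE; have [] := hcompP true (t k).
- by apply/ffunP => k; rewrite !ffunE -hcomp_sum.
Qed.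

Lemma tens_inter t : tens_hdeg false t -> tens_hdeg true t -> t = 0.
Proof.
move=> h0 h1; apply/ffunP => k; rewrite !ffunE.
by apply: hdeg_inter; [exact: h0|exact: h1].
Qed.

Definition tensor : superspace F :=
  Superspace tens_subspace tens_decomp tens_inter.

Definition tens (u : U) (w : W) : tensor := [ffun k => coord b k u *: w].

Lemma tens_bilinear : bilinear_map tens.
Proof.
split=> [u c w w'|w c u u']; apply/ffunP => k; rewrite !ffunE.
  by rewrite scalerDr !scalerA mulrC.
by rewrite linearP scalerDl scalerA.
Qed.

Lemma tens_basis (t : tensor) : t = \sum_(k < n) tens b`_k ((t : {ffun 'I_n -> W}) k).
Proof.
apply/ffunP => k; rewrite sum_ffunE (bigD1 k) //= big1 => [|j njk].
  rewrite ffunE coord_free ?eqxx ?scale1r ?addr0 //.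
  exact: basis_free (vbasisP _).
rewrite ffunE coord_free; last exact: basis_free (vbasisP _).
by rewrite (negbTE njk) scale0r.
Qed.

Lemma tens_universal (X : lmodType F) (f : U -> W -> X) : bilinear_map f ->
  exists! g : tensor -> X, linear g /\ forall u w, g (tens u w) = f u w.
Proof.
move=> [fr fl].
have fr0 u : f u 0 = 0 by apply: linear_eq0.
have frZ u c w : f u (c *: w) = c *: f u w.
  by have := fr u c w 0; rewrite fr0 !addr0.
have fl0 w : f 0 w = 0 by apply: (linear_eq0 (fl w)).
have flZ w c u : f (c *: u) w = c *: f u w.
  by have := fl w c u 0; rewrite /= fl0 !addr0.
exists (fun t => \sum_(k < n) f b`_k ((t : {ffun 'I_n -> W}) k)); split; first split.
- move=> c t t'; rewrite scaler_sumr -big_split; apply: eq_bigr => k _.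
  by rewrite !ffunE fr.
- move=> u w; rewrite {2}(coord_vbasis (memvf u)).
  rewrite (big_morph _ (linear_add (fl w)) (fl0 w)); apply: eq_bigr => k _.
  by rewrite !ffunE frZ flZ.
- move=> g [gl gE]; apply/funext => t.
  rewrite [in RHS](tens_basis t) (big_morph _ (linear_add gl) (linear_eq0 gl)).
  by apply: eq_bigr => k _; rewrite gE.
Qed.

(* phi (x) id_W for a linear map phi : U -> U *)
Definition tens_map (phi : U -> U) (t : tensor) : tensor :=
  \sum_(k < n) tens (phi b`_k) ((t : {ffun 'I_n -> W}) k).

Lemma tens_mapE (phi : U -> U) : linear phi ->
  linear (tens_map phi) /\
  forall u w, tens_map phi (tens u w) = tens (phi u) w.
Proof.
move=> lphi; have [tr tl] := tens_bilinear.
have bil : bilinear_map (fun u w => tens (phi u) w).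
  by split=> [u|w c u u']; [exact: tr|rewrite lphi; apply: tl].
have [g [[gl gE] _]] := tens_universal bil.
suff -> : tens_map phi = g by [].
apply/funext => t; rewrite [in RHS](tens_basis t) /tens_map.
rewrite (big_morph _ (linear_add gl) (linear_eq0 gl)).
by apply: eq_bigr => k _; rewrite gE.
Qed.

End Tensor.

Section Sl2.
Variable F : fieldType.

Definition sl2_space : {vspace 'M[F]_2} :=
  lker (linfun (mxtrace : 'M[F]_2 -> F^o)).
Definition sl2 : vectType F := subvs_of sl2_space.
Definition sl2_mx (x : sl2) : 'M[F]_2 := vsval x.
(* vsproj is the identity on trace-zero matrices, see to_sl2K. *)
Definition to_sl2 (A : 'M[F]_2) : sl2 := vsproj sl2_space A.

Definition nat2 : vectType F := 'cV[F]_2.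

Definition sl2_br (x y : sl2) : sl2 :=
  to_sl2 (sl2_mx x *m sl2_mx y - sl2_mx y *m sl2_mx x).
Definition sl2_e : sl2 := to_sl2 (delta_mx 0 1).
Definition sl2_f : sl2 := to_sl2 (delta_mx 1 0).
Definition sl2_h : sl2 := to_sl2 (delta_mx 0 0 - delta_mx 1 1).

Definition sl2_nat (x : sl2) (v : nat2) : nat2 := sl2_mx x *m v.

Definition kappa (x y : sl2) : F := 4 * \tr (sl2_mx x *m sl2_mx y).

Definition det2 (v w : nat2) : F := \det (row_mx v w : 'M[F]_(2, 1 + 1)).

Definition odot (v w : nat2) : sl2 :=
  (v 0 0 * w 0 0) *: sl2_e
  - (2^-1 * (v 0 0 * w 1 0 + v 1 0 * w 0 0)) *: sl2_h
  - (v 1 0 * w 1 0) *: sl2_f.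

Lemma mem_sl2 (A : 'M[F]_2) : (A \in sl2_space) = (\tr A == 0).
Proof.
pose g : 'M[F]_2 -> F^o := mxtrace.
have lg : linear g by move=> c u v; rewrite /g linearP.
pose gL := GRing.isLinear.Build F 'M[F]_2 F^o *:%R g lg.
pose G : {linear 'M[F]_2 -> F^o} := HB.pack g gL.
by rewrite memv_ker -/g -[linfun g]/(linfun G) lfunE.
Qed.

Lemma to_sl2K (A : 'M[F]_2) : \tr A = 0 -> sl2_mx (to_sl2 A) = A.
Proof. by move=> tA; apply: vsprojK; rewrite mem_sl2 tA. Qed.

Lemma sl2_brE x y :
  sl2_mx (sl2_br x y) = sl2_mx x *m sl2_mx y - sl2_mx y *m sl2_mx x.
Proof. by apply: to_sl2K; rewrite linearB /= mxtrace_mulC subrr. Qed.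

End Sl2.

Section Short.
Variable F : fieldType.

Record lie_superalgebra (g : superspace F) (br : g -> g -> g) : Prop := {
  lie_bilinear : bilinear_map br;
  lie_even : forall i j u v, hdeg i u -> hdeg j v -> hdeg (i (+) j) (br u v);
  lie_anticomm : forall (i j : bool) u v, hdeg i u -> hdeg j v ->
    br u v = - ((-1) ^+ (i * j) *: br v u);
  lie_jacobi : forall (i j k : bool) u v w,
    hdeg i u -> hdeg j v -> hdeg k w ->
    br u (br v w) = br (br u v) w + (-1) ^+ (i * j) *: br v (br u w)
}.

(* sl_2 (x) J (+) V (x) M (+) D, and the action of sl_2 on it for which J, M
   and D are trivial modules. *)
Definition short_space (J M D : superspace F) : superspace F :=
  dsum (dsum (tensor (sl2 F) J) (tensor (nat2 F) M)) D.

Definition short_act (J M D : superspace F) (x : sl2 F)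
    (z : short_space J M D) : short_space J M D :=
  ((tens_map (sl2_br x) z.1.1, tens_map (sl2_nat x) z.1.2), 0).

Record short_sl2_lie_superalgebra (g : superspace F) (br : g -> g -> g)
    (act : sl2 F -> g -> g) : Prop := {
  short_lie : lie_superalgebra br;
  short_act_bilinear : bilinear_map act;
  short_act_br : forall x y u,
    act (sl2_br x y) u = act x (act y u) - act y (act x u);
  short_act_even : forall x i u, hdeg i u -> hdeg i (act x u);
  short_act_der : forall x u v, act x (br u v) = br (act x u) v + br u (act x v);
  short_form : exists (J M D : superspace F) (phi : short_space J M D -> g),
    [/\ linear phi, bijective phi,
        forall i z, hdeg i z -> hdeg i (phi z)
      & forall x z, phi (short_act x z) = act x (phi z)]
}.

End Short.

Section Ternary.
Variable F : fieldType.

Record jordan_superalgebra := JordanSuperalgebra {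
  jspace :> superspace F;
  jmul : jspace -> jspace -> jspace;
  jmul_bilinear : bilinear_map jmul;
  jmul_even : forall i j a b, hdeg i a -> hdeg j b -> hdeg (i (+) j) (jmul a b);
  jmul_comm : forall (i j : bool) a b, hdeg i a -> hdeg j b ->
    jmul a b = (-1) ^+ (i * j) *: jmul b a;
  jmul_jordan : forall (i j k l : bool) a b c d,
    hdeg i a -> hdeg j b -> hdeg k c -> hdeg l d ->
    jmul (jmul a b) (jmul c d)
    + (-1) ^+ (j * k) *: jmul (jmul a c) (jmul b d)
    + (-1) ^+ (j * l + k * l) *: jmul (jmul a d) (jmul b c)
    = jmul (jmul (jmul a b) c) d
    + (-1) ^+ (j * k + j * l + k * l) *: jmul (jmul (jmul a d) c) b
    + (-1) ^+ (i * j + i * k + i * l + k * l) *: jmul (jmul (jmul b d) c) a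
}.

Record special_supermodule (J : jordan_superalgebra) := SpecialSupermodule {
  mspace :> superspace F;
  mact : J -> mspace -> mspace;
  mact_bilinear : bilinear_map mact;
  mact_even : forall i j a m, hdeg i a -> hdeg j m -> hdeg (i (+) j) (mact a m);
  mact_special : forall (i j : bool) a b m, hdeg i a -> hdeg j b ->
    mact (jmul a b) m
    = 2^-1 *: (mact a (mact b m) + (-1) ^+ (i * j) *: mact b (mact a m))
}.

Record ternary_superalgebra := TernarySuperalgebra {
  tJ : jordan_superalgebra;
  tM : special_supermodule tJ;
  star : tM -> tM -> tJ;
  triple : tM -> tM -> tM -> tM;
  star_bilinear : bilinear_map star;
  star_even : forall i j m n, hdeg i m -> hdeg j n ->
    hdeg (i (+) j) (star m n);
  star_anticomm : forall (i j : bool) m n, hdeg i m -> hdeg j n ->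
    star m n = - ((-1) ^+ (i * j) *: star n m);
  triple_linear1 : forall n s, linear (fun m => triple m n s);
  triple_linear2 : forall m s, linear (fun n => triple m n s);
  triple_linear3 : forall m n, linear (fun s => triple m n s);
  triple_even : forall i j k m n s, hdeg i m -> hdeg j n -> hdeg k s ->
    hdeg (i (+) j (+) k) (triple m n s);
  SJT1 : forall (p i j : bool) a m n, hdeg p a -> hdeg i m -> hdeg j n ->
    jmul a (star m n)
    = 2^-1 *: (star (mact a m) n + (-1) ^+ (p * i) *: star m (mact a n));
  SJT2 : forall (p i j k : bool) a m n s,
    hdeg p a -> hdeg i m -> hdeg j n -> hdeg k s ->
    mact a (triple m n s)
    = triple (mact a m) n s - (-1) ^+ (p * i) *: triple m (mact a n) s
      + (-1) ^+ (p * (i + j)) *: triple m n (mact a s);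
  SJT3 : forall (i j k : bool) m n s, hdeg i m -> hdeg j n -> hdeg k s ->
    triple m n s
    = (-1) ^+ (i * (j + k) + j * k) *: triple s n m
      - (-1) ^+ (j * k) *: mact (star m s) n;
  SJT4 : forall (i j k : bool) m n s, hdeg i m -> hdeg j n -> hdeg k s ->
    triple m n s = (-1) ^+ (i * j) *: triple n m s + mact (star m n) s;
  SJT5 : forall (i j k l : bool) m n r s,
    hdeg i m -> hdeg j n -> hdeg k r -> hdeg l s ->
    star (triple m n r) s + (-1) ^+ (k * (i + j)) *: star r (triple m n s)
    = (-1) ^+ (j * (k + l)) *: star m (mact (star r s) n);
  SJT6 : forall (i j k l q : bool) m n r s t,
    hdeg i m -> hdeg j n -> hdeg k r -> hdeg l s -> hdeg q t ->
    triple m n (triple r s t)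
    = triple (triple m n r) s t
      + (-1) ^+ (k * (i + j) + i * j) *: triple r (triple n m s) t
      + (-1) ^+ ((i + j) * (k + l)) *: triple r s (triple m n t)
}.

End Ternary.

Section InnDer.
Variables (F : fieldType) (A : ternary_superalgebra F).

Local Notation J := (tJ A).
Local Notation M := (tM A).
Local Notation "a *j b" := (jmul a b) (at level 40, left associativity).
Local Notation "a *@ m" := (mact a m) (at level 40, left associativity).
Local Notation "m ** n" := (star m n) (at level 40, left associativity).

Definition JM : superspace F := dsum J M.

(* <a, b> for a, b homogeneous of degrees i, j *)
Definition angle (i j : bool) (a b : J) : JM -> JM := fun z =>
  (a *j (b *j z.1) - (-1) ^+ (i * j) *: (b *j (a *j z.1)),
   4^-1 *: (a *@ (b *@ z.2) - (-1) ^+ (i * j) *: (b *@ (a *@ z.2)))).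

(* partial_{m,n} for m, n homogeneous of degrees i, j; its definition on
   homogeneous elements of J (partial_homogeneous) is extended to J by summing
   over homogeneous components. *)
Definition partial (i j : bool) (m n : M) : JM -> JM := fun z =>
  (2^-1 *: \sum_(k : bool)
     ((-1) ^+ (k * (i + j)) *: ((hcomp k z.1 *@ m) ** n)
      - (-1) ^+ (k * j) *: (m ** (hcomp k z.1 *@ n))),
   2^-1 *: ((m ** n) *@ z.2) - triple m n z.2).

Lemma partial_homogeneous (i j k : bool) m n a : hdeg k a ->
  (partial i j m n (a, 0)).1
  = 2^-1 *: ((-1) ^+ (k * (i + j)) *: ((a *@ m) ** n)
             - (-1) ^+ (k * j) *: (m ** (a *@ n))).
Proof.
move=> ha; have [_ ml] := @mact_bilinear _ _ M.
have [sr sl] := @star_bilinear _ A.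
have m0 r : (0 : J) *@ r = 0 := linear_eq0 (ml r).
have s0 r : (0 : M) ** r = 0 := linear_eq0 (sl r).
have s0' r : r ** (0 : M) = 0 := linear_eq0 (sr r).
rewrite /partial /=; congr (_ *: _).
rewrite (bigD1 k) //= big1 => [|l nlk].
  by rewrite (hcomp_hdeg k ha) eqxx addr0.
by rewrite (hcomp_hdeg l ha) (negbTE nlk) !m0 s0 s0' !scaler0 subrr.
Qed.

Inductive innder_gen : set (JM -> JM) :=
| InnderAngle (i j : bool) (a b : J) of hdeg i a & hdeg j b :
    innder_gen (angle i j a b)
| InnderPartial (i j : bool) (m n : M) of hdeg i m & hdeg j n :
    innder_gen (partial i j m n).

(* The span is taken in the space of all maps JM -> JM, of which End(JM) is a
   subspace; see InnDer_linear. *)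
Definition InnDer : set (JM -> JM) := lspan innder_gen.

Definition fun_hdeg (i : bool) : set (JM -> JM) :=
  [set f | forall j z, hdeg j z -> hdeg (i (+) j) (f z)].

Lemma InnDer_subspace : subspace InnDer.
Proof.
split; first by move=> S [[S0 _] _].
by move=> c f g hf hg S SS; apply: (SS.1).2; [exact: hf|exact: hg].
Qed.

Lemma InnDer_linear f : InnDer f -> linear f.
Proof.
apply: (smallest_sub (X := [set f : JM -> JM | linear f])).
  split=> [c x y|k u v lu lv c x y].
    by change (0 = c *: (0 : JM) + 0); rewrite scaler0 addr0.
  change (k *: u (c *: x + y) + v (c *: x + y)
          = c *: (k *: u x + v x) + (k *: u y + v y)).
  by rewrite lu lv !scalerDr addrACA !scalerA mulrC.
have [jr _] := @jmul_bilinear _ J; have [mr ml] := @mact_bilinear _ _ M.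
have [sr sl] := @star_bilinear _ A.
have l1 : linear (fun z : JM => z.1) by [].
have l2 : linear (fun z : JM => z.2) by [].
have lh k : linear (fun z : JM => hcomp k z.1).
  by apply: linear_comp l1; apply: hcomp_linear.
move=> _ [i j a b _ _|i j m n _ _]; apply: linear_pair.
- apply: linear_sub; last apply: linear_scale.
    by do 2 apply: linear_comp (jr _) _.
  by do 2 apply: linear_comp (jr _) _.
- apply/linear_scale/linear_sub; last apply: linear_scale.
    by do 2 apply: linear_comp (mr _) _.
  by do 2 apply: linear_comp (mr _) _.
- apply/linear_scale/linear_sum => k; apply: linear_sub; apply: linear_scale.
    by apply: (linear_comp (sl _)); apply: (linear_comp (ml _)).
  by apply: (linear_comp (sr _)); apply: (linear_comp (ml _)).
- apply: linear_sub; last exact: linear_comp (triple_linear3 _ _) l2.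
  by apply: linear_scale; apply: linear_comp (mr _) l2.
Qed.

Lemma angle_hdeg i j a b :
  hdeg i a -> hdeg j b -> fun_hdeg (i (+) j) (angle i j a b).
Proof.
move=> ha hb k z [h1 h2].
split; [|apply: hdegZ]; (apply: hdegB; [|apply: hdegZ]).
- by rewrite -addbA; apply/jmul_even/jmul_even.
- by rewrite [i (+) j]addbC -addbA; apply/jmul_even/jmul_even.
- by rewrite -addbA; apply/mact_even/mact_even.
- by rewrite [i (+) j]addbC -addbA; apply/mact_even/mact_even.
Qed.

Lemma partial_hdeg i j m n :
  hdeg i m -> hdeg j n -> fun_hdeg (i (+) j) (partial i j m n).
Proof.
move=> hm hn k z [h1 h2]; split; last first.
  apply: hdegB; last exact: triple_even.
  by apply/hdegZ/mact_even => //; apply: star_even.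
apply/hdegZ/hdeg_sum => l; have hl := hdeg_hcomp l h1.
apply: hdegB; apply: hdegZ; rewrite addbC.
  by rewrite addbA; apply/star_even => //; apply: mact_even.
by rewrite addbCA; apply/star_even => //; apply: mact_even.
Qed.

Lemma fun_hdeg_subspace i : subspace (@fun_hdeg i).
Proof.
split; first by move=> j z _; apply: hdeg0.
by move=> c f g hf hg j z hz; apply: hdegD; [apply: hdegZ; apply: hf|apply: hg].
Qed.

Lemma InnDer_decomp f : InnDer f -> exists f0 f1,
  [/\ InnDer f0 /\ fun_hdeg false f0, InnDer f1 /\ fun_hdeg true f1
     & f = f0 + f1].
Proof.
have [I0 Il] := InnDer_subspace.
have [[E0 El] [O0 Ol]] := (fun_hdeg_subspace false, fun_hdeg_subspace true).
apply: (smallest_sub (X := [set f | exists f0 f1, [/\ _ /\ _, _ /\ _ & f = f0 + f1]])).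
  split; first by exists 0, 0; rewrite addr0.
  move=> c u v [f0 [f1 [[If0 Ef0] [If1 Of1] ->]]].
  move=> [g0 [g1 [[Ig0 Eg0] [Ig1 Og1] ->]]].
  exists (c *: f0 + g0), (c *: f1 + g1); rewrite scalerDr addrACA.
  by split=> //; split; [apply: Il|apply: El|apply: Il|apply: Ol].
move=> g gg; have Ig : InnDer g by apply: sub_gen_smallest.
have [i hi] : exists i, fun_hdeg i g.
  by case: gg => [i j a b ha hb|i j a b ha hb]; exists (i (+) j);
    [apply: angle_hdeg|apply: partial_hdeg].
case: i hi => hi; [exists 0, g|exists g, 0]; rewrite ?add0r ?addr0.
  by split.
by split.
Qed.

Definition InnDer_mem : {pred JM -> JM} := fun f => f \in InnDer.

Lemma InnDer_submod_closed : submod_closed InnDer_mem.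
Proof.
have [I0 Il] := InnDer_subspace.
split; first exact: mem_set.
move=> c f g hf hg; apply: mem_set; apply: Il; first exact: (set_mem hf).
exact: (set_mem hg).
Qed.

HB.instance Definition _ :=
  GRing.isSubmodClosed.Build F (JM -> JM) InnDer_mem InnDer_submod_closed.

Record innder_type := InnderType {
  innder_val :> JM -> JM;
  _ : innder_val \in InnDer_mem
}.

HB.instance Definition _ := [isSub for innder_val].
HB.instance Definition _ := [Choice of innder_type by <:].
HB.instance Definition _ := [SubChoice_isSubLmodule of innder_type by <:].

Definition innder_hdeg (i : bool) : set innder_type :=
  [set d | fun_hdeg i (innder_val d)].

Lemma innder_hdeg_subspace i : subspace (@innder_hdeg i).
Proof.
have [E0 El] := fun_hdeg_subspace i.
split; first exact: E0.
by move=> c u v hu hv; apply: El.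
Qed.

Lemma innder_hdeg_decomp d : exists d0 d1,
  [/\ innder_hdeg false d0, innder_hdeg true d1 & d = d0 + d1].
Proof.
case: d => f If; have [f0 [f1 [[I0 E0] [I1 O1] e]]] := InnDer_decomp (set_mem If).
exists (InnderType (mem_set I0)), (InnderType (mem_set I1)); split=> //.
exact: val_inj.
Qed.

Lemma innder_hdeg_inter d : innder_hdeg false d -> innder_hdeg true d -> d = 0.
Proof.
case: d => f If hE hO; apply: val_inj; apply/funext => z /=.
have [z0 [z1 [h0 h1 ->]]] := hdeg_decomp z.
rewrite (linear_add (InnDer_linear (set_mem If))).
have -> : f z0 = 0 by apply: hdeg_inter; [apply: hE h0|apply: hO h0].
have -> : f z1 = 0 by apply: hdeg_inter; [apply: hO h1|apply: hE h1].
by rewrite addr0.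
Qed.

Definition innder : superspace F :=
  Superspace innder_hdeg_subspace innder_hdeg_decomp innder_hdeg_inter.

End InnDer.

Section GJM.
Variables (F : fieldType) (A : ternary_superalgebra F).

Local Notation J := (tJ A).
Local Notation M := (tM A).

Definition gJM : superspace F := short_space J M (innder A).
Definition gJM_act (x : sl2 F) (z : gJM) : gJM := short_act x z.

Definition xJ (x : sl2 F) (a : J) : gJM := ((tens x a, 0), 0).
Definition vM (v : nat2 F) (m : M) : gJM := ((0, tens v m), 0).
Definition inD (d : innder A) : gJM := (0, d).

(* The inclusion of g(J, M) into sl_2 (x) J (+) V (x) M (+) End(J (+) M), in
   which the bracket formulas can be written before knowing that their last
   component lies in InnDer(J, M). *)
Definition gval (z : gJM) :
    (tensor (sl2 F) J * tensor (nat2 F) M * (JM A -> JM A))%type :=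
  (z.1.1, z.1.2, innder_val z.2).

Record gJM_bracket (br : gJM -> gJM -> gJM) : Prop := {
  br_bilinear : bilinear_map br;
  br_anticomm : forall (i j : bool) u v, hdeg i u -> hdeg j v ->
    br u v = - ((-1) ^+ (i * j) *: br v u);
  br_DD : forall (i j : bool) (d d' : innder A), hdeg i d -> hdeg j d' ->
    gval (br (inD d) (inD d'))
    = (0, 0, (d \o d' : JM A -> JM A)
             - (-1) ^+ (i * j) *: (d' \o d : JM A -> JM A));
  br_DJ : forall (d : innder A) x a,
    br (inD d) (xJ x a) = xJ x (innder_val d (a, 0)).1;
  br_DM : forall (d : innder A) v m,
    br (inD d) (vM v m) = vM v (innder_val d (0, m)).2;
  br_JJ : forall (i j : bool) x y (a b : J), hdeg i a -> hdeg j b ->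
    gval (br (xJ x a) (xJ y b))
    = (tens (sl2_br x y) (jmul a b), 0, (2^-1 * kappa x y) *: angle i j a b);
  br_JM : forall x v (a : J) (m : M),
    br (xJ x a) (vM v m) = vM (sl2_nat x v) (mact a m);
  br_MM : forall (i j : bool) v w (m n : M), hdeg i m -> hdeg j n ->
    gval (br (vM v m) (vM w n))
    = (tens (odot v w) (star m n), 0, det2 v w *: partial i j m n)
}.

End GJM.

(* Main.v *)
Require Import Defs.
From mathcomp Require Import all_boot all_algebra complex reals.
From mathcomp Require Import boolp classical_sets functions ring.
Local Open Scope complex_scope.

Set Implicit Arguments.
Unset Strict Implicit.
Unset Printing Implicit Defensive.

Import GRing.Theory.
Local Open Scope ring_scope.

(** The elements x (x) a, v (x) m and d span g(J, M), and the prescribed formulas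
    together with super-anticommutativity give the bracket of any two of them;
    so there is at most one such bracket (gJM_bracket_unique).  It exists
    because the formulas are multilinear on homogeneous elements: the bracket is
    first written with values in sl_2 (x) J (+) V (x) M (+) End(J (+) M)
    (graded_bracket), and its last component lies in InnDer(J, M) because
    InnDer(J, M) is closed under supercommutators (InnDer_scomm).

    The Jacobi identity is trilinear and, by super-anticommutativity, invariant
    under permutations of its arguments (jacobi_swap12, jacobi_swap23).  It is
    therefore enough to check ten kinds of triples of generators.

    - With an inner derivation d among the arguments, the identity says that d
      is a superderivation of the four operations of (J, M), which also gives
      the brackets of d with <a, b> and partial_{m,n} (scomm_angle,
      scomm_partial).  A homogeneous inner derivation is a combination of
      generators <a, b> and partial_{m,n} of its own degree
      (InnDer_hdeg_ind), so this need only be known for the generators: for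
      <a, b> it follows from the Jordan identity (angle_jmul) and from the fact
      that the action of a, applied to one factor at a time, is compatible with
      star and, with alternating signs, with the triple product (angle_star,
      angle_triple); for partial_{m,n} it follows from SJT1, SJT5, SJT6 and
      from a consequence of SJT2 and SJT4 (triple_mactB).

    - For three elements of sl_2 (x) J, each iterated bracket in sl_2 is a
      combination of x, y, z with the values of the trace form as coefficients
      (sl2_br_br).  Comparing these coefficients, the component in sl_2 (x) J
      is the definition of <a, b>; the inner component is the cyclic identity
      angle_jmul_cyclic.

    - For two elements of sl_2 (x) J and one of V (x) M, write the product xy
      of matrices as [x, y] / 2 + tr(xy) / 2 (nat_nat); what remains is the
      identity defining special modules.

    - For one element of sl_2 (x) J and two of V (x) M, the component in
      sl_2 (x) J is SJT1 and the formula for partial_{m,n} on J, and the inner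
      component expresses <a, m star n> through partial (angle_star_partial).

    - For three elements of V (x) M, the relation
      det(v,w) u + det(w,u) v + det(u,v) w = 0 leaves only terms in v and w, and
      their coefficients agree by SJT3 and SJT4 (triple_swap23).

    Identities between linear combinations are settled by comparing
    coefficients, for each choice of parities (tactic lmod). *)

(** * Identities between linear combinations *)

Section LinearExpressions.
Variables (F : fieldType) (V : lmodType F).

Inductive lexp :=
| LAtom of nat | LZero | LAdd of lexp & lexp | LOpp of lexp
| LScale of F & lexp.

Fixpoint leval (env : seq V) (e : lexp) : V :=
  match e with
  | LAtom n => env`_n
  | LZero => 0
  | LAdd e1 e2 => leval env e1 + leval env e2
  | LOpp e1 => - leval env e1
  | LScale c e1 => c *: leval env e1
  end.

Fixpoint lcoef (e : lexp) (n : nat) : F :=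
  match e with
  | LAtom m => if eqn m n then 1 else 0
  | LZero => 0
  | LAdd e1 e2 => lcoef e1 n + lcoef e2 n
  | LOpp e1 => - lcoef e1 n
  | LScale c e1 => c * lcoef e1 n
  end.

Fixpoint same_coefs (e1 e2 : lexp) (n : nat) : Prop :=
  if n is m.+1 then lcoef e1 m = lcoef e2 m /\ same_coefs e1 e2 m else True.

Lemma leval_coef env e :
  leval env e = \sum_(i < size env) lcoef e i *: env`_i.
Proof.
elim: e => [m||e1 IH1 e2 IH2|e IH|c e IH] /=.
- have [ltm|lem] := ltnP m (size env); last first.
    rewrite nth_default // big1 // => i _; case: (@eqnP m i) => [mi|_].
      by move: (ltn_ord i); rewrite -mi ltnNge lem.
    by rewrite scale0r.
  rewrite (bigD1 (Ordinal ltm)) //= eqnE eqxx scale1r big1 ?addr0 // => i.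
  by rewrite -val_eqE /= eq_sym => /negPf ->; rewrite scale0r.
- by rewrite big1 // => i _; rewrite scale0r.
- by rewrite IH1 IH2 -big_split; apply: eq_bigr => i _; rewrite /= scalerDl.
- by rewrite IH -sumrN; apply: eq_bigr => i _; rewrite scaleNr.
- by rewrite IH scaler_sumr; apply: eq_bigr => i _; rewrite scalerA.
Qed.

(** Two formal combinations of the same vectors have the same value as soon as
    their coefficients agree, which turns an identity in a module into finitely
    many identities between scalars. *)
Lemma leval_eq env e1 e2 :
  same_coefs e1 e2 (size env) -> leval env e1 = leval env e2.
Proof.
move=> sc; rewrite !leval_coef; apply: eq_bigr => i _; congr (_ *: _).
elim: (size env) (i : nat) (ltn_ord i) sc => //= n IH k.
by rewrite ltnS leq_eqVlt => /predU1P [->|ltk] [? ?] //; apply: IH.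
Qed.

End LinearExpressions.

Ltac lin_index env x :=
  lazymatch env with
  | nil => fail
  | cons ?y ?env' =>
    match constr:(Set) with
    | _ => let _ := match constr:(Set) with _ => constr_eq x y end in constr:(O)
    | _ => let k := lin_index env' x in constr:(S k)
    end
  end.

Ltac lin_insert env x :=
  match constr:(Set) with
  | _ => let _ := lin_index env x in env
  | _ => let T := type of env in
         lazymatch T with @seq ?V => constr:(@cons V x env)
                        | @list ?V => constr:(@cons V x env) end
  end.

(** Anything that is not a sum, an opposite, a scaling or zero is an atom; atoms
    are compared syntactically. *)
Ltac lin_atoms env t :=
  lazymatch t with
  | @GRing.add _ ?a ?b => let env' := lin_atoms env a in lin_atoms env' b
  | @GRing.opp _ ?a => lin_atoms env a
  | @GRing.scale _ _ _ ?a => lin_atoms env a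
  | @GRing.zero _ => env
  | ?x => lin_insert env x
  end.

Ltac lin_reify F env t :=
  lazymatch t with
  | @GRing.add _ ?a ?b =>
      let a' := lin_reify F env a in let b' := lin_reify F env b in
      constr:(@LAdd F a' b')
  | @GRing.opp _ ?a => let a' := lin_reify F env a in constr:(@LOpp F a')
  | @GRing.scale _ _ ?c ?a =>
      let a' := lin_reify F env a in constr:(@LScale F c a')
  | @GRing.zero _ => constr:(@LZero F)
  | ?x => let k := lin_index env x in constr:(@LAtom F k)
  end.

(** Unifying an equation with this form makes its field and its module, which
    are needed for the reification, available to the tactic below. *)
Definition lin_goal (F : fieldType) (V : lmodType F) (x y : V) : Prop := x = y.

Lemma lin_goalP (F : fieldType) (V : lmodType F) (x y : V) :
  lin_goal x y -> x = y.
Proof. by []. Qed.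

Ltac lin_coefs :=
  apply: lin_goalP;
  lazymatch goal with |- @lin_goal ?F ?V ?x ?y =>
    let env := lin_atoms (@nil V) x in
    let env := lin_atoms env y in
    let e1 := lin_reify F env x in
    let e2 := lin_reify F env y in
    change (@leval F V env e1 = @leval F V env e2)
  end;
  apply: leval_eq;
  cbn [size same_coefs lcoef eqn];
  repeat (split; [|]); try exact I.

(** The coefficients contain Koszul signs whose exponents depend on parities;
    once the parities are fixed, these exponents are numerals. *)
Ltac eval_signs :=
  repeat match goal with
  | i : bool |- context [ nat_of_bool ?b] =>
      lazymatch b with context [ i] => destruct i end
  end;
  repeat match goal with |- context [ @GRing.exp ?R ?x ?n] =>
    lazymatch n with context [ nat_of_bool] =>
    let m := eval cbv in n in
    change (@GRing.exp R x n) with (@GRing.exp R x m) end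
  end.

(** Decides equations between linear combinations whose coefficients are built
    from Koszul signs, rational numbers and arbitrary scalars. *)
Ltac lmod := lin_coefs; eval_signs; by field.

(** * The Lie algebra sl_2 and its natural module *)

Section Sl2Coordinates.
Variable F : numFieldType.
Implicit Types (x y z : sl2 F) (v w u : nat2 F).
Local Notation tau x y := (\tr (sl2_mx x *m sl2_mx y)).

(** An element of sl_2 is determined by three of its entries, written a, b, c as
    in the matrix with rows (a, b) and (c, -a). *)
Definition sl2a x : F := sl2_mx x 0 0.
Definition sl2b x : F := sl2_mx x 0 1.
Definition sl2c x : F := sl2_mx x 1 0.
Definition nat_fst v : F := v 0 0.
Definition nat_snd v : F := v 1 0.

Lemma mul_mx2E (n : nat) (A : 'M[F]_2) (B : 'M[F]_(2, n)) i j :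
  (A *m B) i j = A i 0 * B 0 j + A i 1 * B 1 j.
Proof.
rewrite mxE !big_ord_recl big_ord0 addr0.
by congr (_ * _ + _ * _); [congr (A _ _)|congr (B _ _)]; apply: val_inj.
Qed.

Lemma mxtrace2 (A : 'M[F]_2) : \tr A = A 0 0 + A 1 1.
Proof.
rewrite /mxtrace !big_ord_recl big_ord0 addr0.
by congr (_ + A _ _); apply: val_inj.
Qed.

Lemma det_mx2 (A : 'M[F]_2) : \det A = A 0 0 * A 1 1 - A 0 1 * A 1 0.
Proof.
rewrite (expand_det_row _ 0) !big_ord_recl big_ord0 addr0 /cofactor.
rewrite !det_mx11 !mxE expr0 mul1r expr1 mulN1r mulrN.
by congr (_ * A _ _ - A _ _ * A _ _); apply: val_inj.
Qed.

Lemma ord2P (k : 'I_2) : k = 0 \/ k = 1.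
Proof. by case: k => [[|[|]]] // ?; [left|right]; apply: val_inj. Qed.

Lemma nat2P v w : nat_fst v = nat_fst w -> nat_snd v = nat_snd w -> v = w.
Proof.
move=> h0 h1; apply/matrixP => i j; rewrite ord1.
by case: (ord2P i) => ->.
Qed.

Lemma sl2_mx11 x : sl2_mx x 1 1 = - sl2a x.
Proof.
have := subvsP x; rewrite mem_sl2 mxtrace2 addrC addr_eq0 => /eqP ->.
by [].
Qed.

Lemma sl2P x y : sl2a x = sl2a y -> sl2b x = sl2b y -> sl2c x = sl2c y -> x = y.
Proof.
move=> h00 h01 h10; apply: val_inj; apply/matrixP => i j.
case: (ord2P i) => ->; case: (ord2P j) => -> //.
by rewrite -!/(sl2_mx _) !sl2_mx11 h00.
Qed.

Lemma sl2_mxD x y : sl2_mx (x + y) = sl2_mx x + sl2_mx y.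
Proof. by rewrite /sl2_mx linearD. Qed.
Lemma sl2_mxZ c x : sl2_mx (c *: x) = c *: sl2_mx x.
Proof. by rewrite /sl2_mx linearZ. Qed.

Lemma sl2_eE : sl2_mx (sl2_e F) = delta_mx 0 1.
Proof. by apply: to_sl2K; rewrite mxtrace2 !mxE /= addr0. Qed.
Lemma sl2_fE : sl2_mx (sl2_f F) = delta_mx 1 0.
Proof. by apply: to_sl2K; rewrite mxtrace2 !mxE /= addr0. Qed.
Lemma sl2_hE : sl2_mx (sl2_h F) = delta_mx 0 0 - delta_mx 1 1.
Proof. by apply: to_sl2K; rewrite mxtrace2 !mxE /= subr0 sub0r subrr. Qed.

Lemma det2E v w : det2 v w = nat_fst v * nat_snd w - nat_snd v * nat_fst w.
Proof.
have e0 : (0 : 'I_(1 + 1)) = lshift 1 0 by apply: val_inj.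
have e1 : (1 : 'I_(1 + 1)) = rshift 1 0 by apply: val_inj.
have E0 i : (row_mx v w : 'M_(2, 1 + 1)) i 0 = v i 0 by rewrite e0 row_mxEl.
have E1 i : (row_mx v w : 'M_(2, 1 + 1)) i 1 = w i 0 by rewrite e1 row_mxEr.
by rewrite /det2 det_mx2 !E0 !E1 [w 0 0 * _]mulrC.
Qed.

Lemma sl2aD x y : sl2a (x + y) = sl2a x + sl2a y.
Proof. by rewrite /sl2a sl2_mxD mxE. Qed.
Lemma sl2bD x y : sl2b (x + y) = sl2b x + sl2b y.
Proof. by rewrite /sl2b sl2_mxD mxE. Qed.
Lemma sl2cD x y : sl2c (x + y) = sl2c x + sl2c y.
Proof. by rewrite /sl2c sl2_mxD mxE. Qed.
Lemma sl2aZ k x : sl2a (k *: x) = k * sl2a x.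
Proof. by rewrite /sl2a sl2_mxZ mxE. Qed.
Lemma sl2bZ k x : sl2b (k *: x) = k * sl2b x.
Proof. by rewrite /sl2b sl2_mxZ mxE. Qed.
Lemma sl2cZ k x : sl2c (k *: x) = k * sl2c x.
Proof. by rewrite /sl2c sl2_mxZ mxE. Qed.
Lemma nat_fstD v w : nat_fst (v + w) = nat_fst v + nat_fst w.
Proof. by rewrite /nat_fst mxE. Qed.
Lemma nat_sndD v w : nat_snd (v + w) = nat_snd v + nat_snd w.
Proof. by rewrite /nat_snd mxE. Qed.
Lemma nat_fstZ k v : nat_fst (k *: v) = k * nat_fst v.
Proof. by rewrite /nat_fst mxE. Qed.
Lemma nat_sndZ k v : nat_snd (k *: v) = k * nat_snd v.
Proof. by rewrite /nat_snd mxE. Qed.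

Lemma sl2_br_coords x y :
  ((sl2a (sl2_br x y) = sl2b x * sl2c y - sl2b y * sl2c x)%R
  * (sl2b (sl2_br x y) = 2 * (sl2a x * sl2b y - sl2b x * sl2a y))%R
  * (sl2c (sl2_br x y) = 2 * (sl2c x * sl2a y - sl2a x * sl2c y))%R)%type.
Proof.
have E i j : sl2_mx (sl2_br x y) i j
    = (sl2_mx x *m sl2_mx y) i j - (sl2_mx y *m sl2_mx x) i j.
  by rewrite sl2_brE mxE [X in _ + X]mxE.
split; [split|]; rewrite [LHS]E !mul_mx2E ?sl2_mx11 -?[sl2_mx _ 0 0]/(sl2a _);
  rewrite -?[sl2_mx _ 0 1]/(sl2b _) -?[sl2_mx _ 1 0]/(sl2c _); ring.
Qed.

Lemma sl2_traceE x y : tau x y =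
  2 * sl2a x * sl2a y + sl2b x * sl2c y + sl2c x * sl2b y.
Proof.
rewrite mxtrace2 !mul_mx2E !sl2_mx11 -![sl2_mx _ 0 0]/(sl2a _).
rewrite -![sl2_mx _ 0 1]/(sl2b _) -![sl2_mx _ 1 0]/(sl2c _); ring.
Qed.

Lemma odot_coords v w :
  ((sl2a (odot v w) = - (2^-1 * (nat_fst v * nat_snd w + nat_snd v * nat_fst w)))%R
  * (sl2b (odot v w) = nat_fst v * nat_fst w)%R
  * (sl2c (odot v w) = - (nat_snd v * nat_snd w))%R)%type.
Proof.
rewrite /odot -![v 0 0]/(nat_fst v) -![w 0 0]/(nat_fst w).
rewrite -![v 1 0]/(nat_snd v) -![w 1 0]/(nat_snd w).
split; [split|]; rewrite -?scaleNr ?(sl2aD, sl2bD, sl2cD, sl2aZ, sl2bZ, sl2cZ);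
  rewrite /sl2a /sl2b /sl2c sl2_eE sl2_fE sl2_hE !mxE /=; ring.
Qed.

Lemma sl2_nat_coords x v :
  ((nat_fst (sl2_nat x v) = sl2a x * nat_fst v + sl2b x * nat_snd v)%R
  * (nat_snd (sl2_nat x v) = sl2c x * nat_fst v - sl2a x * nat_snd v)%R)%type.
Proof.
by split; rewrite [LHS]mul_mx2E // sl2_mx11 mulNr.
Qed.

Definition sl2DZ := (sl2aD, sl2bD, sl2cD, sl2aZ, sl2bZ, sl2cZ, nat_fstD, nat_sndD,
  nat_fstZ, nat_sndZ).

Ltac sl2_field :=
  rewrite -?scaleNr -?scaleN1r ?(sl2_traceE, det2E);
  rewrite ?(sl2_br_coords, odot_coords, sl2_nat_coords, sl2DZ);
  by field.

(** This follows from xy + yx = tr(xy), valid for traceless 2 x 2 matrices. *)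
Lemma sl2_br_br x y z :
  sl2_br x (sl2_br y z) = (2 * tau x y) *: z - (2 * tau x z) *: y.
Proof.
apply: sl2P; sl2_field.
Qed.

Lemma odot_equivariant x v w :
  sl2_br x (odot v w) = odot (sl2_nat x v) w + odot v (sl2_nat x w).
Proof.
apply: sl2P; sl2_field.
Qed.

Lemma odot_skew x v w :
  odot (sl2_nat x v) w - odot v (sl2_nat x w) = - det2 v w *: x.
Proof.
apply: sl2P; sl2_field.
Qed.

Lemma nat_nat x y v : sl2_nat x (sl2_nat y v)
  = 2^-1 *: sl2_nat (sl2_br x y) v + (2^-1 * tau x y) *: v.
Proof.
apply: nat2P; sl2_field.
Qed.

Lemma odot_nat v w u :
  sl2_nat (odot v w) u = 2^-1 *: (det2 v u *: w + det2 w u *: v).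
Proof.
apply: nat2P; sl2_field.
Qed.

Lemma det2_cyclic v w u : det2 v w *: u = det2 v u *: w - det2 w u *: v.
Proof.
apply: nat2P; sl2_field.
Qed.

Lemma det2_invariant x v w : det2 (sl2_nat x v) w = - det2 v (sl2_nat x w).
Proof.
sl2_field.
Qed.

(** Up to scale, odot is the moment map of V: it is dual, for the trace form, to
    the symmetric form (v, w) |-> det(x v, w). *)
Lemma trace_odot x v w : tau x (odot v w) = - det2 (sl2_nat x v) w.
Proof.
sl2_field.
Qed.

Lemma trace_br x y z : tau x (sl2_br y z) = tau (sl2_br x y) z.
Proof.
sl2_field.
Qed.
Lemma sl2_brC x y : sl2_br x y = - sl2_br y x.
Proof. by apply: sl2P; sl2_field. Qed.

Lemma sl2_br_bilinear : bilinear_map (@sl2_br F).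
Proof. by split=> [x|y] k y1 y2; apply: sl2P; sl2_field. Qed.

Lemma sl2_nat_bilinear : bilinear_map (@sl2_nat F).
Proof. by split=> [x|v] k v1 v2; apply: nat2P; sl2_field. Qed.

Lemma odot_bilinear : bilinear_map (@odot F).
Proof. by split=> [x|v] k v1 v2; apply: sl2P; sl2_field. Qed.

Lemma odotC v w : odot v w = odot w v.
Proof. by apply: sl2P; sl2_field. Qed.

Lemma det2C v w : det2 v w = - det2 w v.
Proof. by sl2_field. Qed.

Lemma sl2_jacobi x y z :
  sl2_br x (sl2_br y z) = sl2_br (sl2_br x y) z + sl2_br y (sl2_br x z).
Proof. by apply: sl2P; sl2_field. Qed.

Lemma sl2_br_nat x y v :
  sl2_nat (sl2_br x y) v = sl2_nat x (sl2_nat y v) - sl2_nat y (sl2_nat x v).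
Proof. by apply: nat2P; sl2_field. Qed.

(** The same as odot_nat, with w and u as arguments of the symmetric product,
    but without the vector u: it is eliminated by det2_cyclic. *)
Lemma odot_nat2 v w u : sl2_nat (odot w u) v
  = (2^-1 * det2 w u) *: v - det2 v u *: w.
Proof. by apply: nat2P; sl2_field. Qed.

Lemma trace_form_bilinear : @bilinear_map F (sl2 F) (sl2 F) F^o
  (fun x y => tau x y).
Proof.
split=> [x|v] k y z; rewrite -[RHS]/(k * _ + _); sl2_field.
Qed.

Lemma det2_bilinear : @bilinear_map F (nat2 F) (nat2 F) F^o (@det2 F).
Proof.
split=> [x|v] k y z; rewrite -[RHS]/(k * _ + _); sl2_field.
Qed.

Lemma traceC x y : tau x y = tau y x.
Proof. by rewrite mxtrace_mulC. Qed.

Lemma sl2_br_brl x y z :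
  sl2_br (sl2_br x y) z = (2 * tau y z) *: x - (2 * tau x z) *: y.
Proof. by apply: sl2P; sl2_field. Qed.

Lemma trace_br_swap x y z :
  tau y (sl2_br x z) = - tau x (sl2_br y z).
Proof. by sl2_field. Qed.

End Sl2Coordinates.

(** * Linear and bilinear maps *)


Lemma linearE3 (F : fieldType) (U V : lmodType F) (f : U -> V) : linear f ->
  (forall u v, f (u + v) = f u + f v) * (forall c u, f (c *: u) = c *: f u)
  * (forall u, f (- u) = - f u) * (f 0 = 0).
Proof.
move=> lf; have f0 : f 0 = 0 by apply: linear_eq0.
have fZ c u : f (c *: u) = c *: f u by have := lf c u 0; rewrite f0 !addr0.
split=> //; split=> [|u]; last by rewrite -scaleN1r fZ scaleN1r.
by split=> // u v; apply: linear_add.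
Qed.

Section LinearMaps.
Variables (F : fieldType) (U V W : lmodType F).

Lemma bilinearE (f : U -> V -> W) : bilinear_map f ->
  (forall u u' v, f (u + u') v = f u v + f u' v)
  * (forall u v v', f u (v + v') = f u v + f u v')
  * (forall c u v, f (c *: u) v = c *: f u v)
  * (forall c u v, f u (c *: v) = c *: f u v)
  * (forall u v, f (- u) v = - f u v) * (forall u v, f u (- v) = - f u v)
  * (forall v, f 0 v = 0) * (forall u, f u 0 = 0).
Proof.
move=> [fr fl]; have El v := linearE3 (fl v); have Er u := linearE3 (fr u).
by do !split=> *; rewrite ?Er // [LHS](El _).
Qed.

Lemma linear_combination1 (c : F) (x y u v : V) :
  u = v -> x - y = c *: (u - v) -> x = y.
Proof. by move=> ->; rewrite subrr scaler0 => /subr0_eq. Qed.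

(** To derive an equation from others, it suffices to exhibit it as a linear
    combination of them. *)
Lemma linear_combination2 (c d : F) (x y u v u' v' : V) :
  u = v -> u' = v' -> x - y = c *: (u - v) + d *: (u' - v') -> x = y.
Proof. by move=> -> ->; rewrite !subrr !scaler0 addr0 => /subr0_eq. Qed.

Lemma linear_combination3 (c d e : F) (x y u v u' v' u'' v'' : V) :
  u = v -> u' = v' -> u'' = v'' ->
  x - y = c *: (u - v) + d *: (u' - v') + e *: (u'' - v'') -> x = y.
Proof. by move=> -> -> ->; rewrite !subrr !scaler0 !addr0 => /subr0_eq. Qed.

End LinearMaps.

(** * Superderivations of a ternary superalgebra *)

Section Derivations.
Variables (F : numFieldType) (A : ternary_superalgebra F).
Local Notation J := (tJ A).
Local Notation M := (tM A).
Local Notation "a *j b" := (@jmul _ J a b) (at level 40, left associativity).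
Local Notation "a *@ m" := (@mact _ J M a m) (at level 40, left associativity).
Local Notation "m ** n" := (@star _ A m n) (at level 40, left associativity).

Definition jmulE := bilinearE (@jmul_bilinear _ J).
Definition mactE := bilinearE (@mact_bilinear _ J M).
Definition starE := bilinearE (@star_bilinear _ A).
Lemma tripleE :
  (forall m n r s, @triple _ A (m + n) r s = triple m r s + triple n r s)
  * (forall m n r s, @triple _ A m (n + r) s = triple m n s + triple m r s)
  * (forall m n r s, @triple _ A m n (r + s) = triple m n r + triple m n s)
  * (forall c m n r, @triple _ A (c *: m) n r = c *: triple m n r)
  * (forall c m n r, @triple _ A m (c *: n) r = c *: triple m n r)
  * (forall c m n r, @triple _ A m n (c *: r) = c *: triple m n r)
  * (forall m n r, @triple _ A (- m) n r = - triple m n r)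
  * (forall m n r, @triple _ A m (- n) r = - triple m n r)
  * (forall m n r, @triple _ A m n (- r) = - triple m n r)
  * (forall n r, @triple _ A 0 n r = 0) * (forall m r, @triple _ A m 0 r = 0)
  * (forall m n, @triple _ A m n 0 = 0).
Proof.
have E1 n s := linearE3 (@triple_linear1 _ A n s).
have E2 m s := linearE3 (@triple_linear2 _ A m s).
have E3 m n := linearE3 (@triple_linear3 _ A m n).
by do !split=> *; rewrite ?E3 // ?E1 // ?[LHS](E2 _) // ?[LHS](E1 _).
Qed.
Definition operationE := (jmulE, mactE, starE, tripleE).

Definition dJ (d : JM A -> JM A) (a : J) : J := (d (a, 0)).1.
Definition dM (d : JM A -> JM A) (m : M) : M := (d (0, m)).2.

(** The fields sder_J and sder_M say that the operator preserves J and M, so that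
    dJ and dM describe it completely. *)
Record superderivation (k : bool) (d : JM A -> JM A) : Prop := {
  sder_linear : linear d;
  sder_hdeg : fun_hdeg k d;
  sder_J : forall a : J, (d (a, 0)).2 = 0;
  sder_M : forall m : M, (d (0, m)).1 = 0;
  sder_jmul : forall i j (a b : J), hdeg i a -> hdeg j b ->
    dJ d (a *j b) = dJ d a *j b + (-1) ^+ (k * i) *: (a *j dJ d b);
  sder_mact : forall i j (a : J) (m : M), hdeg i a -> hdeg j m ->
    dM d (a *@ m) = dJ d a *@ m + (-1) ^+ (k * i) *: (a *@ dM d m);
  sder_star : forall i j (m n : M), hdeg i m -> hdeg j n ->
    dJ d (m ** n) = dM d m ** n + (-1) ^+ (k * i) *: (m ** dM d n);
  sder_triple : forall i j l (m n r : M), hdeg i m -> hdeg j n -> hdeg l r ->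
    dM d (triple m n r) = triple (dM d m) n r
      + (-1) ^+ (k * i) *: triple m (dM d n) r
      + (-1) ^+ (k * (i + j)) *: triple m n (dM d r)
}.

Lemma dJ_angle i j (a b c : J) :
  dJ (angle i j a b) c = a *j (b *j c) - (-1) ^+ (i * j) *: (b *j (a *j c)).
Proof. by []. Qed.

Lemma dM_angle i j (a b : J) (m : M) :
  dM (angle i j a b) m
  = 4^-1 *: (a *@ (b *@ m) - (-1) ^+ (i * j) *: (b *@ (a *@ m))).
Proof. by []. Qed.

Lemma dJ_partial i j k (m n : M) (a : J) : hdeg k a ->
  dJ (partial i j m n) a
  = 2^-1 *: ((-1) ^+ (k * (i + j)) *: ((a *@ m) ** n)
             - (-1) ^+ (k * j) *: (m ** (a *@ n))).
Proof. exact: partial_homogeneous. Qed.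

Lemma dM_partial i j (m n r : M) :
  dM (partial i j m n) r = 2^-1 *: ((m ** n) *@ r) - triple m n r.
Proof. by []. Qed.

Section Angle.
Variables (i j : bool) (a b : J).
Hypotheses (ha : hdeg i a) (hb : hdeg j b).

(** In the Jordan identity the left-hand side is supersymmetric in all four
    arguments, whereas the right-hand side singles out the third one.
    Subtracting the identity with the first and the third arguments exchanged
    therefore leaves a relation that involves these two arguments through the
    commutator of their multiplication operators, and this relation is the
    derivation rule. *)
Lemma angle_jmul k l (c d : J) : hdeg k c -> hdeg l d ->
  dJ (angle i j a b) (c *j d) = dJ (angle i j a b) c *j d
    + (-1) ^+ ((i (+) j) * k) *: (c *j dJ (angle i j a b) d).
Proof.
move=> hc hd; rewrite !dJ_angle !operationE.
have hac := jmul_even ha hc; have hbc := jmul_even hb hc.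
have had := jmul_even ha hd; have hbd := jmul_even hb hd.
have hcd := jmul_even hc hd.
(* The two instances differ by the exchange of a and b; H1 has b, and H2 has a,
   in the distinguished third place. *)
have H1 := jmul_jordan ha hc hb hd; have H2 := jmul_jordan hb hc ha hd.
move: H1 H2.
rewrite (jmul_comm hc hb) (jmul_comm hc ha) (jmul_comm hb ha) !operationE.
rewrite (jmul_comm hbc had) (jmul_comm hbd hac).
rewrite (jmul_comm hac hb) (jmul_comm (jmul_even had hb) hc).
rewrite (jmul_comm had hb) (jmul_comm (jmul_even hcd hb) ha).
rewrite (jmul_comm hcd hb) (jmul_comm hbc ha) (jmul_comm (jmul_even hbd ha) hc).
rewrite (jmul_comm hbd ha) (jmul_comm (jmul_even hcd ha) hb) (jmul_comm hcd ha).
rewrite !operationE => H1 H2.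
(* The coefficients make the two terms of dJ_angle appear: the first is minus
   the sign of a *j (b *j (c *j d)) in H1, the second is the sign of
   b *j (a *j (c *j d)) in H2, times the sign (-1) ^+ (i * j) of dJ_angle. *)
apply: (linear_combination2 (c := - (-1) ^+ (k * j))
  (d := (-1) ^+ (i * j + k * i)) H1 H2).
lmod.
Qed.

(** In terms of operators on M, the rule says that the element <a, b>(c) of J
    acts as [[a, b], c] / 4.  It does, since a . b acts by half of the
    anticommutator of a and b. *)
Lemma angle_mact k (c : J) (m : M) : hdeg k c ->
  dM (angle i j a b) (c *@ m) = dJ (angle i j a b) c *@ m
    + (-1) ^+ ((i (+) j) * k) *: (c *@ dM (angle i j a b) m).
Proof.
move=> hc; rewrite dJ_angle !dM_angle !operationE.
rewrite (mact_special _ ha (jmul_even hb hc)).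
rewrite (mact_special _ hb (jmul_even ha hc)).
rewrite !(mact_special _ hb hc) !(mact_special _ ha hc) !operationE.
lmod.
Qed.

(** By SJT1, a acts on a product by half the sum of its actions on the two
    factors.  These two actions supercommute, so the commutator of a and b acts
    on the factors one at a time, with the factor 1/4 of <a, b>. *)
Lemma angle_star k l (m n : M) : hdeg k m -> hdeg l n ->
  dJ (angle i j a b) (m ** n) = dM (angle i j a b) m ** n
    + (-1) ^+ ((i (+) j) * k) *: (m ** dM (angle i j a b) n).
Proof.
move=> hm hn; rewrite dJ_angle !dM_angle.
rewrite (SJT1 hb hm hn) (SJT1 ha hm hn) !operationE.
rewrite (SJT1 ha (mact_even hb hm) hn) (SJT1 ha hm (mact_even hb hn)).
rewrite (SJT1 hb (mact_even ha hm) hn) (SJT1 hb hm (mact_even ha hn)).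
lmod.
Qed.

(** As for angle_star: by SJT2 the action of a on a triple product is the
    alternating sum of its actions on the three factors, which supercommute;
    the signs disappear in the commutator of a and b. *)
Lemma angle_triple k l q (m n r : M) : hdeg k m -> hdeg l n -> hdeg q r ->
  let d := dM (angle i j a b) in
  d (triple m n r) = triple (d m) n r
    + (-1) ^+ ((i (+) j) * k) *: triple m (d n) r
    + (-1) ^+ ((i (+) j) * (k + l)) *: triple m n (d r).
Proof.
move=> hm hn hr d; rewrite /d !dM_angle.
rewrite (SJT2 ha hm hn hr) (SJT2 hb hm hn hr) !operationE.
rewrite (SJT2 ha (mact_even hb hm) hn hr) (SJT2 ha hm (mact_even hb hn) hr).
rewrite (SJT2 ha hm hn (mact_even hb hr)).
rewrite (SJT2 hb (mact_even ha hm) hn hr) (SJT2 hb hm (mact_even ha hn) hr).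
rewrite (SJT2 hb hm hn (mact_even ha hr)).
lmod.
Qed.

End Angle.

Section Partial.
Variables (i j : bool) (m n : M).
Hypotheses (hm : hdeg i m) (hn : hdeg j n).

(** Two instances of SJT2, for (m, n, r) and for (n, m, r), determine how
    the action of a on a triple product differs from its action on the last
    factor, once SJT4 is used to bring all triple products to the order m, n, r
    and the action of the product of a and m star n is expanded by the axiom of
    special modules. *)
Lemma triple_mactB p k (a : J) (r : M) : hdeg p a -> hdeg k r ->
  a *@ triple m n r - (-1) ^+ (p * (i + j)) *: triple m n (a *@ r)
  = (a *@ m ** n) *@ r - (-1) ^+ (p * (i + j)) *: ((m ** n) *@ (a *@ r)).
Proof.
move=> ha hr; have ham := mact_even ha hm; have han := mact_even ha hn.
have har := mact_even ha hr.
have E1 := SJT2 ha hm hn hr; have E2 := SJT2 ha hn hm hr.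
have E3 := mact_special r ha (star_even hm hn).
move: E2 E3; rewrite (SJT4 hn hm hr) (SJT4 hn ham hr) (SJT4 han hm hr).
rewrite (SJT4 hn hm har) (star_anticomm hn hm) (star_anticomm hn ham).
rewrite (star_anticomm han hm) (SJT1 ha hm hn) !operationE => E2 E3.
apply: (linear_combination3 (c := 2^-1) (d := 2^-1 * (-1) ^+ (i * j)) (e := - 1) E1 E2 E3).
lmod.
Qed.

Lemma partial_jmul k l (a b : J) : hdeg k a -> hdeg l b ->
  dJ (partial i j m n) (a *j b) = dJ (partial i j m n) a *j b
    + (-1) ^+ ((i (+) j) * k) *: (a *j dJ (partial i j m n) b).
Proof.
move=> ha hb.
have ham := mact_even ha hm; have han := mact_even ha hn.
have hbm := mact_even hb hm; have hbn := mact_even hb hn.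
rewrite (dJ_partial i j m n ha) (dJ_partial i j m n hb).
rewrite (dJ_partial i j m n (jmul_even ha hb)).
rewrite !(mact_special _ ha hb) !operationE.
rewrite (jmul_comm (star_even ham hn) hb) (jmul_comm (star_even hm han) hb).
rewrite (SJT1 hb ham hn) (SJT1 hb hm han) (SJT1 ha hbm hn) (SJT1 ha hm hbn).
lmod.
Qed.

Lemma partial_mact k l (a : J) (r : M) : hdeg k a -> hdeg l r ->
  dM (partial i j m n) (a *@ r) = dJ (partial i j m n) a *@ r
    + (-1) ^+ ((i (+) j) * k) *: (a *@ dM (partial i j m n) r).
Proof.
move=> ha hr; have E1 := triple_mactB ha hr.
have E2 := mact_special r ha (star_even hm hn).
move: E2; rewrite (SJT1 ha hm hn) (dJ_partial i j m n ha) !dM_partial !operationE => E2.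
apply: (linear_combination2 (c := (-1) ^+ ((i (+) j) * k)) (d := (-1) ^+ ((i (+) j) * k)) E1 E2).
lmod.
Qed.

(** SJT5 evaluates the triple products in the right-hand side; the remaining
    terms are the two expansions by SJT1 of the product of m star n and
    r star s. *)
Lemma partial_star k l (r s : M) : hdeg k r -> hdeg l s ->
  dJ (partial i j m n) (r ** s) = dM (partial i j m n) r ** s
    + (-1) ^+ ((i (+) j) * k) *: (r ** dM (partial i j m n) s).
Proof.
move=> hr hs; have hrs := star_even hr hs; have hmn := star_even hm hn.
have E1 := SJT5 hm hn hr hs; have E2 := SJT1 hmn hr hs.
have E3 := SJT1 hrs hm hn.
rewrite (dJ_partial i j m n hrs) !dM_partial !operationE.
move: E3; rewrite (jmul_comm hrs hmn) => E3.
apply: (linear_combination3 (c := 1) (d := 1) (e := - (-1) ^+ ((k (+) l) * (i (+) j))) E1 E2 E3).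
lmod.
Qed.

(** The triple product part is SJT6 and the star part is SJT2; they differ
    from the derivation rule in the middle factor only, where SJT4 repairs the
    discrepancy. *)
Lemma partial_triple k l q (r s t : M) : hdeg k r -> hdeg l s -> hdeg q t ->
  let d := dM (partial i j m n) in
  d (triple r s t) = triple (d r) s t
    + (-1) ^+ ((i (+) j) * k) *: triple r (d s) t
    + (-1) ^+ ((i (+) j) * (k + l)) *: triple r s (d t).
Proof.
move=> hr hs ht d; rewrite /d !dM_partial (SJT6 hm hn hr hs ht).
rewrite (SJT2 (star_even hm hn) hr hs ht) (SJT4 hm hn hs) !operationE.
lmod.
Qed.

End Partial.

End Derivations.

(** * Inner superderivations *)

Section InnerDerivations.
Variables (F : numFieldType) (A : ternary_superalgebra F).
Local Notation J := (tJ A).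
Local Notation M := (tM A).
Local Notation "a *j b" := (@jmul _ J a b) (at level 40, left associativity).
Local Notation "a *@ m" := (@mact _ J M a m) (at level 40, left associativity).
Local Notation "m ** n" := (@star _ A m n) (at level 40, left associativity).

Lemma InnDer_angle i j (a b : J) : hdeg i a -> hdeg j b ->
  @InnDer _ A (angle i j a b).
Proof. by move=> ha hb; apply: sub_gen_smallest; apply: InnderAngle. Qed.

Lemma InnDer_partial i j (m n : M) : hdeg i m -> hdeg j n ->
  @InnDer _ A (partial i j m n).
Proof. by move=> hm hn; apply: sub_gen_smallest; apply: InnderPartial. Qed.

Lemma superderivation_angle i j (a b : J) : hdeg i a -> hdeg j b ->
  superderivation (i (+) j) (angle i j a b).
Proof.
move=> ha hb; split.
- exact: InnDer_linear (InnDer_angle ha hb).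
- exact: angle_hdeg.
- by move=> c; rewrite /angle /= !operationE !scaler0 subrr scaler0.
- by move=> m; rewrite /angle /= !operationE !scaler0 subrr.
- exact: angle_jmul.
- by move=> k l c m hc _; apply: angle_mact hc.
- exact: angle_star.
- exact: angle_triple.
Qed.

Lemma superderivation_partial i j (m n : M) : hdeg i m -> hdeg j n ->
  superderivation (i (+) j) (partial i j m n).
Proof.
move=> hm hn; split.
- exact: InnDer_linear (InnDer_partial hm hn).
- exact: partial_hdeg.
- by move=> c; rewrite /partial /= !operationE scaler0 subrr.
- move=> r; rewrite -[LHS]/(dJ (partial i j m n) 0).
  by rewrite (dJ_partial i j m n (hdeg0 J false)) !operationE !scaler0 subrr scaler0.
- exact: partial_jmul.
- by move=> k l c r hc hr; apply: partial_mact hc hr.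
- exact: partial_star.
- exact: partial_triple.
Qed.

Lemma JM_linear_ext (X : lmodType F) (f g : JM A -> X) :
  linear f -> linear g ->
  (forall k (a : J), hdeg k a -> f (a, 0) = g (a, 0)) ->
  (forall k (m : M), hdeg k m -> f (0, m) = g (0, m)) -> f = g.
Proof.
move=> lf lg hJ hM; apply/funext => -[a m].
have -> : (a, m) = (hcomp false a, 0) + (hcomp true a, 0)
                   + ((0, hcomp false m) + (0, hcomp true m)) :> JM A.
  by apply: injective_projections;
    rewrite /= !add0r ?addr0 -hcomp_sum.
rewrite !(linearE3 lf) !(linearE3 lg).
have hp (V : superspace F) k (v : V) := (hcompP k v).1.
by congr (_ + _ + (_ + _)); [apply: hJ (hp _ _ _)|apply: hJ (hp _ _ _)
  |apply: hM (hp _ _ _)|apply: hM (hp _ _ _)].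
Qed.

(** The supercommutator with sign (-1)^s, where s stands for the product of the
    two degrees. *)
Definition scomm (s : nat) (d d' : JM A -> JM A) : JM A -> JM A :=
  (d \o d' : JM A -> JM A) - (-1) ^+ s *: (d' \o d : JM A -> JM A).

Lemma linear_dJ (d : JM A -> JM A) : linear d -> linear (dJ d).
Proof.
move=> ld c a b; rewrite /dJ.
have -> : (c *: a + b, 0) = c *: (a, 0) + (b, 0) :> JM A.
  by congr pair; rewrite /= ?scaler0 ?addr0.
by rewrite ld.
Qed.

Lemma linear_dM (d : JM A -> JM A) : linear d -> linear (dM d).
Proof.
move=> ld c m n; rewrite /dM.
have -> : (0, c *: m + n) = c *: (0, m) + (0, n) :> JM A.
  by congr pair; rewrite /= ?scaler0 ?addr0.
by rewrite ld.
Qed.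

Lemma linear_addf (X Y : lmodType F) (f g : X -> Y) :
  linear f -> linear g -> linear (fun x => f x + g x).
Proof. by move=> lf lg c x y; rewrite lf lg scalerDr addrACA. Qed.

Lemma linear_scomm s (d d' : JM A -> JM A) :
  linear d -> linear d' -> linear (scomm s d d').
Proof.
move=> ld ld'; apply: linear_sub; first exact: linear_comp.
by apply: linear_scale; apply: linear_comp.
Qed.

Section Superderivation.
Variables (k : bool) (d : JM A -> JM A).
Hypothesis sd : superderivation k d.

Lemma sder_inl (a : J) : d (a, 0) = (dJ d a, 0).
Proof. by rewrite [LHS]surjective_pairing (sder_J sd). Qed.

Lemma sder_inr (m : M) : d (0, m) = (0, dM d m).
Proof. by rewrite [LHS]surjective_pairing (sder_M sd). Qed.

Lemma dJE :
  (forall a b, dJ d (a + b) = dJ d a + dJ d b)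
  * (forall c a, dJ d (c *: a) = c *: dJ d a) * (forall a, dJ d (- a) = - dJ d a)
  * (dJ d 0 = 0).
Proof. exact: linearE3 (linear_dJ (sder_linear sd)). Qed.

Lemma dME :
  (forall m n, dM d (m + n) = dM d m + dM d n)
  * (forall c m, dM d (c *: m) = c *: dM d m) * (forall m, dM d (- m) = - dM d m)
  * (dM d 0 = 0).
Proof. exact: linearE3 (linear_dM (sder_linear sd)). Qed.

Lemma hdeg_dJ i (a : J) : hdeg i a -> hdeg (k (+) i) (dJ d a).
Proof.
move=> ha; have hz : hdeg i ((a, 0) : JM A) by split=> //; apply: hdeg0.
exact: (sder_hdeg sd hz).1.
Qed.

Lemma hdeg_dM i (m : M) : hdeg i m -> hdeg (k (+) i) (dM d m).
Proof.
move=> hm; have hz : hdeg i ((0, m) : JM A) by split=> //; apply: hdeg0.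
exact: (sder_hdeg sd hz).2.
Qed.

End Superderivation.

Lemma scomm_inl s k k' d d' (a : J) :
  superderivation k d -> superderivation k' d' ->
  scomm s d d' (a, 0) = (dJ d (dJ d' a) - (-1) ^+ s *: dJ d' (dJ d a), 0).
Proof.
move=> sd sd'; rewrite -[LHS]/(d (d' (a, 0)) - (-1) ^+ s *: d' (d (a, 0))).
rewrite !(sder_inl sd, sder_inl sd').
by congr pair; rewrite /= ?scaler0 ?subrr.
Qed.

Lemma scomm_inr s k k' d d' (m : M) :
  superderivation k d -> superderivation k' d' ->
  scomm s d d' (0, m) = (0, dM d (dM d' m) - (-1) ^+ s *: dM d' (dM d m)).
Proof.
move=> sd sd'; rewrite -[LHS]/(d (d' (0, m)) - (-1) ^+ s *: d' (d (0, m))).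
rewrite !(sder_inr sd, sder_inr sd').
by congr pair; rewrite /= ?scaler0 ?subrr.
Qed.

(** A superderivation respects everything that is defined by the operations, in
    particular the formation of <a, b>. *)
Lemma scomm_angle k d i j (a b : J) : superderivation k d ->
  hdeg i a -> hdeg j b ->
  scomm (k * (i (+) j)) d (angle i j a b)
  = angle (k (+) i) j (dJ d a) b
    + (-1) ^+ (k * i) *: angle i (k (+) j) a (dJ d b).
Proof.
move=> sd ha hb.
have hda := hdeg_dJ sd ha; have hdb := hdeg_dJ sd hb.
have s0 := superderivation_angle ha hb.
have s1 := superderivation_angle hda hb.
have s2 := superderivation_angle ha hdb.
apply: JM_linear_ext.
- exact: linear_scomm (sder_linear sd) (sder_linear s0).
- by apply: linear_addf (sder_linear s1) _; apply: linear_scale (sder_linear s2).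
- move=> l c hc; rewrite (scomm_inl _ _ sd s0).
  rewrite -[RHS]/(angle _ _ _ _ (c, 0) + _ *: angle _ _ _ _ (c, 0)).
  rewrite (sder_inl s1) (sder_inl s2); congr pair; last by rewrite /= scaler0 addr0.
  rewrite !dJ_angle !(dJE sd) (sder_jmul sd ha (jmul_even hb hc)).
  rewrite (sder_jmul sd hb (jmul_even ha hc)) (sder_jmul sd ha hc).
  rewrite (sder_jmul sd hb hc) !operationE /=.
  lmod.
- move=> l r hr; rewrite (scomm_inr _ _ sd s0).
  rewrite -[RHS]/(angle _ _ _ _ (0, r) + _ *: angle _ _ _ _ (0, r)).
  rewrite (sder_inr s1) (sder_inr s2); congr pair; first by rewrite /= scaler0 addr0.
  rewrite !dM_angle !(dME sd) (sder_mact sd ha (mact_even hb hr)).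
  rewrite (sder_mact sd hb (mact_even ha hr)) (sder_mact sd ha hr).
  rewrite (sder_mact sd hb hr) !operationE /=.
  lmod.
Qed.

Lemma scomm_partial k d i j (m n : M) : superderivation k d ->
  hdeg i m -> hdeg j n ->
  scomm (k * (i (+) j)) d (partial i j m n)
  = partial (k (+) i) j (dM d m) n
    + (-1) ^+ (k * i) *: partial i (k (+) j) m (dM d n).
Proof.
move=> sd hm hn.
have hdm := hdeg_dM sd hm; have hdn := hdeg_dM sd hn.
have s0 := superderivation_partial hm hn.
have s1 := superderivation_partial hdm hn.
have s2 := superderivation_partial hm hdn.
apply: JM_linear_ext.
- exact: linear_scomm (sder_linear sd) (sder_linear s0).
- by apply: linear_addf (sder_linear s1) _; apply: linear_scale (sder_linear s2).
- move=> l c hc; rewrite (scomm_inl _ _ sd s0).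
  rewrite -[RHS]/(partial _ _ _ _ (c, 0) + _ *: partial _ _ _ _ (c, 0)).
  rewrite (sder_inl s1) (sder_inl s2).
  congr pair; last by rewrite /= scaler0 addr0.
  have hcm := mact_even hc hm; have hcn := mact_even hc hn.
  rewrite /= !(dJ_partial _ _ _ _ hc) (dJ_partial _ _ _ _ (hdeg_dJ sd hc)).
  rewrite !(dJE sd) (sder_star sd hcm hn) (sder_star sd hm hcn).
  rewrite (sder_mact sd hc hm) (sder_mact sd hc hn) !operationE.
  lmod.
- move=> l r hr; rewrite (scomm_inr _ _ sd s0).
  rewrite -[RHS]/(partial _ _ _ _ (0, r) + _ *: partial _ _ _ _ (0, r)).
  rewrite (sder_inr s1) (sder_inr s2).
  congr pair; first by rewrite /= scaler0 addr0.
  rewrite /= !dM_partial !(dME sd) (sder_mact sd (star_even hm hn) hr).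
  rewrite (sder_triple sd hm hn hr) (sder_star sd hm hn) !operationE.
  lmod.
Qed.

(** On J this is the Jordan identity itself.  On M it is the identity
    [a, {b, c}] = [{a, b}, c] - [b, {a, c}] of associative algebras. *)
Lemma angle_jmul_cyclic i j k (a b c : J) :
  hdeg i a -> hdeg j b -> hdeg k c ->
  angle i (j (+) k) a (b *j c)
  = angle (i (+) j) k (a *j b) c
    - (-1) ^+ (i * j) *: angle j (i (+) k) b (a *j c).
Proof.
move=> ha hb hc.
have hab := jmul_even ha hb; have hac := jmul_even ha hc.
have hbc := jmul_even hb hc.
have s0 := superderivation_angle ha hbc.
have s1 := superderivation_angle hab hc.
have s2 := superderivation_angle hb hac.
apply: JM_linear_ext.
- exact: sder_linear s0.
- apply: linear_sub; first exact: sder_linear s1.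
  by apply: linear_scale (sder_linear s2).
- move=> l d hd.
  rewrite -[RHS]/(angle _ _ _ _ (d, 0) - _ *: angle _ _ _ _ (d, 0)).
  rewrite (sder_inl s0) (sder_inl s1) (sder_inl s2).
  congr pair; last by rewrite /= scaler0 subrr.
  have had := jmul_even ha hd; have hbd := jmul_even hb hd.
  have hcd := jmul_even hc hd.
  have := jmul_jordan ha hb hd hc; rewrite /= !dJ_angle.
  rewrite (jmul_comm hd hc) (jmul_comm had hbc).
  rewrite (jmul_comm (jmul_even hab hd) hc) (jmul_comm (jmul_even hac hd) hb).
  rewrite (jmul_comm (jmul_even hbc hd) ha) !operationE => E.
  apply: (linear_combination1 (c := - (-1) ^+ (l * k)) E).
  lmod.
- move=> l r hr.
  rewrite -[RHS]/(angle _ _ _ _ (0, r) - _ *: angle _ _ _ _ (0, r)).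
  rewrite (sder_inr s0) (sder_inr s1) (sder_inr s2).
  congr pair; first by rewrite /= scaler0 subrr.
  rewrite /= !dM_angle !(mact_special _ hb hc) !(mact_special _ ha hb).
  rewrite !(mact_special _ ha hc) !operationE.
  lmod.
Qed.

(** On J both sides are given by SJT1.  On M, triple_mactB computes
    the action of a on (m, n, r) up to (m, n, a r), and SJT2 computes it
    through the triple products that occur in the right-hand side. *)
Lemma angle_star_partial p i j (a : J) (m n : M) :
  hdeg p a -> hdeg i m -> hdeg j n ->
  angle p (i (+) j) a (m ** n)
  = - 2^-1 *: (partial (p (+) i) j (a *@ m) n
               - (-1) ^+ (p * i) *: partial i (p (+) j) m (a *@ n)).
Proof.
move=> ha hm hn.
have ham := mact_even ha hm; have han := mact_even ha hn.
have hmn := star_even hm hn.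
have s0 := superderivation_angle ha hmn.
have s1 := superderivation_partial ham hn.
have s2 := superderivation_partial hm han.
apply: JM_linear_ext.
- exact: sder_linear s0.
- apply: linear_scale; apply: linear_sub; first exact: sder_linear s1.
  by apply: linear_scale (sder_linear s2).
- move=> l c hc.
  rewrite -[RHS]/(_ *: (partial _ _ _ _ (c, 0) - _ *: partial _ _ _ _ (c, 0))).
  rewrite (sder_inl s0) (sder_inl s1) (sder_inl s2).
  congr pair; last by rewrite /= scaler0 subrr scaler0.
  have hcm := mact_even hc hm; have hcn := mact_even hc hn.
  have hac := jmul_even ha hc.
  rewrite /= !dJ_angle !(dJ_partial _ _ _ _ hc).
  rewrite (jmul_comm hmn hc) (jmul_comm hmn hac) !operationE.
  rewrite (SJT1 hc hm hn) (SJT1 hac hm hn) !operationE.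
  rewrite (SJT1 ha hcm hn) (SJT1 ha hm hcn) !(mact_special _ ha hc) !operationE.
  lmod.
- move=> l r hr.
  rewrite -[RHS]/(_ *: (partial _ _ _ _ (0, r) - _ *: partial _ _ _ _ (0, r))).
  rewrite (sder_inr s0) (sder_inr s1) (sder_inr s2).
  congr pair; first by rewrite /= scaler0 subrr scaler0.
  have E1 := triple_mactB hm hn ha hr.
  have E2 := mact_special r ha hmn; have E3 := SJT2 ha hm hn hr.
  move: E2; rewrite (SJT1 ha hm hn) /= !dM_angle !dM_partial !operationE => E2.
  apply: (linear_combination3 (c := - 2^-1) (d := - 2^-1) (e := 2^-1) E1 E2 E3).
  lmod.
Qed.

(** The transposition of the last two arguments is the composite of the
    transposition of the first two (SJT4), of the outer two (SJT3) and of the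
    first two again. *)
Lemma triple_swap23 i j k (m n r : M) : hdeg i m -> hdeg j n -> hdeg k r ->
  triple m r n = (-1) ^+ (j * k) *: (triple m n r - (m ** n) *@ r)
    + (-1) ^+ (i * j + i * k + j * k) *: ((n ** r) *@ m) + (m ** r) *@ n.
Proof.
move=> hm hn hr; have E1 := SJT4 hm hn hr; have E2 := SJT3 hn hm hr.
have E3 := SJT4 hm hr hn.
apply: (linear_combination3 (c := - (-1) ^+ (j * k)) (d := - (-1) ^+ (i * j + j * k))
  (e := 1) E1 E2 E3).
lmod.
Qed.

Lemma sder_subspace k : subspace [set d : JM A -> JM A | superderivation k d].
Proof.
split=> [|c f g sf sg].
  split.
  - by move=> c x y; rewrite -[RHS]/(c *: (0 : JM A) + 0) scaler0 addr0.
  - by move=> j z _; apply: hdeg0.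
  - by [].
  - by [].
  - by move=> i j a b _ _; rewrite /dJ /= !operationE scaler0 addr0.
  - by move=> i j a b _ _; rewrite /dJ /dM /= !operationE scaler0 addr0.
  - by move=> i j a b _ _; rewrite /dJ /dM /= !operationE scaler0 addr0.
  - by move=> i j l a b r _ _ _; rewrite /dM /= !operationE ?scaler0 !addr0.
have EJ a : dJ (c *: f + g) a = c *: dJ f a + dJ g a by [].
have EM a : dM (c *: f + g) a = c *: dM f a + dM g a by [].
split.
- apply: linear_addf; last exact: sder_linear sg.
  exact: linear_scale (sder_linear sf).
- exact: (fun_hdeg_subspace _ _).2 (sder_hdeg sf) (sder_hdeg sg).
- move=> a; rewrite -[LHS]/(c *: (f (a, 0)).2 + (g (a, 0)).2).
  by rewrite (sder_J sf) (sder_J sg) scaler0 addr0.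
- move=> m; rewrite -[LHS]/(c *: (f (0, m)).1 + (g (0, m)).1).
  by rewrite (sder_M sf) (sder_M sg) scaler0 addr0.
- move=> i j a b ha hb; rewrite !EJ (sder_jmul sf ha hb) (sder_jmul sg ha hb).
  by rewrite !operationE; lmod.
- move=> i j a b ha hb; rewrite !EJ !EM (sder_mact sf ha hb) (sder_mact sg ha hb).
  by rewrite !operationE; lmod.
- move=> i j a b ha hb; rewrite !EJ !EM (sder_star sf ha hb) (sder_star sg ha hb).
  by rewrite !operationE; lmod.
- move=> i j l a b r ha hb hr.
  rewrite !EM (sder_triple sf ha hb hr) (sder_triple sg ha hb hr).
  by rewrite !operationE; lmod.
Qed.

(** All generators are homogeneous, hence the homogeneous component of degree k
    of an inner derivation is a combination of generators of degree k. *)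
Lemma InnDer_hdeg_ind k (P : set (JM A -> JM A)) : subspace P ->
  (forall i j (a b : J), hdeg i a -> hdeg j b -> i (+) j = k ->
     P (angle i j a b)) ->
  (forall i j (m n : M), hdeg i m -> hdeg j n -> i (+) j = k ->
     P (partial i j m n)) ->
  forall d, InnDer d -> fun_hdeg k d -> P d.
Proof.
move=> [P0 Pl] Pa Pp d Id hd.
pose Q (d : JM A -> JM A) := exists f g,
  [/\ P f, fun_hdeg k f, fun_hdeg (~~ k) g, linear g & d = f + g].
have [[Z0 Zl] [N0 Nl]] := (@fun_hdeg_subspace _ A k, @fun_hdeg_subspace _ A (~~ k)).
have l0 : linear (0 : JM A -> JM A).
  by move=> c x y; rewrite -[RHS]/(c *: (0 : JM A) + 0) scaler0 addr0.
have Qk f : P f -> fun_hdeg k f -> Q f.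
  by move=> Pf hf; exists f, 0; rewrite addr0.
have Qn i f : fun_hdeg i f -> linear f -> i != k -> Q f.
  move=> hf lf ik; exists 0, f; rewrite add0r; split=> //.
  by rewrite (_ : ~~ k = i) //; case: (i) (k) ik => [] [].
have [f [g [Pf hf hg lg e]]] : Q d.
  apply: (smallest_sub (X := Q)) Id.
    split; first exact: Qk.
    move=> c u v [f [g [Pf hf hg lg ->]]] [f' [g' [Pf' hf' hg' lg' ->]]].
    exists (c *: f + f'), (c *: g + g').
    split; [exact: Pl|exact: Zl|exact: Nl| |].
      by apply: linear_addf lg'; apply: linear_scale.
    by rewrite scalerDr addrACA.
  move=> _ [i j a b ha hb|i j m n hm hn]; case: (eqVneq (i (+) j) k) => ij.
  - by apply: Qk; [apply: Pa|rewrite -ij; apply: angle_hdeg].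
  - apply: Qn ij; first exact: angle_hdeg.
    exact: InnDer_linear (InnDer_angle ha hb).
  - by apply: Qk; [apply: Pp|rewrite -ij; apply: partial_hdeg].
  - apply: Qn ij; first exact: partial_hdeg.
    exact: InnDer_linear (InnDer_partial hm hn).
(* g has both degrees: k, as the difference of d and f, and the other one. *)
suff g0 : g = 0 by rewrite e g0 addr0.
apply/funext => z; have gz i (y : JM A) : hdeg i y -> g y = 0.
  move=> hy; apply: (@hdeg_disj _ (JM A) (k (+) i)).
    have -> : g y = d y - f y by rewrite e -[(f + g) y]/(f y + g y) addrC addKr.
    by apply: hdegB; [apply: hd|apply: hf].
  by rewrite -addNb; apply: hg.
rewrite [z]hcomp_sum (linear_add lg).
by rewrite !(gz _ _ (hcompP _ _).1) addr0.
Qed.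

Lemma superderivation_InnDer k (d : JM A -> JM A) : InnDer d -> fun_hdeg k d ->
  superderivation k d.
Proof.
apply: (InnDer_hdeg_ind (sder_subspace k)) => i j a b ha hb <-.
  exact: superderivation_angle.
exact: superderivation_partial.
Qed.

(** By scomm_angle and scomm_partial, the supercommutator of a superderivation
    with a generator is a combination of generators. *)
Lemma InnDer_scomm k l (d d' : JM A -> JM A) : InnDer d -> fun_hdeg k d ->
  InnDer d' -> fun_hdeg l d' -> InnDer (scomm (k * l) d d').
Proof.
move=> Id hd; have sd := superderivation_InnDer Id hd.
have [I0 Il] := @InnDer_subspace _ A.
have IN c f : @InnDer _ A f -> InnDer (c *: f).
  by move=> If; rewrite -[_ *: _]addr0; apply: Il.
have ID f g : @InnDer _ A f -> InnDer g -> InnDer (f + g).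
  by move=> If Ig; rewrite -[f]scale1r; apply: Il.
apply: (InnDer_hdeg_ind (P := [set d' | InnDer (scomm (k * l) d d')])).
- split=> [|c f g If Ig] /=.
    suff -> : scomm (k * l) d 0 = 0 by [].
    apply/funext => z; rewrite -[LHS]/(d 0 - _ *: 0).
    by rewrite scaler0 subr0 (linear_eq0 (sder_linear sd)).
  suff -> : scomm (k * l) d (c *: f + g)
      = c *: scomm (k * l) d f + scomm (k * l) d g by apply: Il.
  apply/funext => z; rewrite /scomm.
  rewrite -[LHS]/(d (c *: f z + g z) - _ *: (c *: f (d z) + g (d z))).
  rewrite -[RHS]/(c *: (d (f z) - _ *: f (d z)) + (d (g z) - _ *: g (d z))).
  by rewrite (sder_linear sd); lmod.
- move=> i j a b ha hb <- /=; rewrite (scomm_angle sd ha hb).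
  apply: ID; last apply: IN.
    exact: InnDer_angle (hdeg_dJ sd ha) hb.
  exact: InnDer_angle ha (hdeg_dJ sd hb).
- move=> i j a b ha hb <- /=; rewrite (scomm_partial sd ha hb).
  apply: ID; last apply: IN.
    exact: InnDer_partial (hdeg_dM sd ha) hb.
  exact: InnDer_partial ha (hdeg_dM sd hb).
Qed.

End InnerDerivations.

(** * Generators of the superspace g(J, M) *)

Section Generators.
Variables (F : numFieldType) (A : ternary_superalgebra F).
Local Notation J := (tJ A).
Local Notation M := (tM A).
Local Notation g := (gJM A).

Lemma xJ_bilinear : bilinear_map (@xJ _ A).
Proof.
have [tr tl] := @tens_bilinear _ (sl2 F) J.
by split=> [x|a] c u v; rewrite /xJ ?tr ?[tens _ _]tl;
  do ?congr pair; rewrite /= ?scaler0 ?addr0.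
Qed.

Lemma vM_bilinear : bilinear_map (@vM _ A).
Proof.
have [tr tl] := @tens_bilinear _ (nat2 F) M.
by split=> [x|a] c u v; rewrite /vM ?tr ?[tens _ _]tl;
  do ?congr pair; rewrite /= ?scaler0 ?addr0.
Qed.

Lemma inD_linear : linear (@inD _ A).
Proof. by move=> c d d'; congr pair; rewrite /= scaler0 addr0. Qed.

Lemma innder_val_linear : linear (@innder_val _ A).
Proof. by move=> c d e; exact: (linearP (\val : innder_type A -> _)). Qed.

Lemma gval_linear : linear (@gval _ A).
Proof.
move=> c [[X P] d] [[Y Q] e]; rewrite /gval.
by congr (_, _, _); rewrite -innder_val_linear.
Qed.

Lemma gval_inj : injective (@gval _ A).
Proof.
move=> [[X P] d] [[Y Q] d'] [eX eP ed]; congr (_, _, _) => //.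
by apply: val_inj.
Qed.

Lemma hdeg_xJ i x (a : J) : hdeg i a -> hdeg i (xJ x a : g).
Proof.
move=> ha; split; last exact: hdeg0.
by split; [move=> k; rewrite ffunE; apply: hdegZ|apply: hdeg0].
Qed.

Lemma hdeg_vM i v (m : M) : hdeg i m -> hdeg i (vM v m : g).
Proof.
move=> hm; split; last exact: hdeg0.
by split; [apply: hdeg0|move=> k; rewrite ffunE; apply: hdegZ].
Qed.

Lemma hdeg_inD i (d : innder A) : hdeg i d -> hdeg i (inD d : g).
Proof. by move=> hd; split=> //; split; apply: hdeg0. Qed.

(** The inclusion of InnDer(J, M) into g(J, M), extended to all maps by the value
    0, so that no proof of membership occurs in the formulas. *)
Definition inF (f : JM A -> JM A) : g := inD (insubd (0 : innder A) f).

Lemma inFK (d : innder A) : inF (innder_val d) = inD d.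
Proof. by rewrite /inF valKd. Qed.

Lemma InnDer_val (d : innder A) : InnDer (innder_val d).
Proof. by case: d => f If; apply: set_mem. Qed.

Lemma insubdIK f : InnDer f -> innder_val (insubd (0 : innder A) f) = f.
Proof. by move=> If; apply: insubdK; apply: mem_set. Qed.

Lemma gval_inF f : InnDer f -> gval (inF f) = (0, 0, f).
Proof. by move=> If; rewrite /gval /= insubdIK. Qed.

Lemma gval_inFP (u : g) f : InnDer f -> gval u = (0, 0, f) -> u = inF f.
Proof. by move=> If eu; apply: gval_inj; rewrite gval_inF. Qed.

Lemma inF_linear c f h : InnDer f -> InnDer h ->
  inF (c *: f + h) = c *: inF f + inF h.
Proof.
move=> If Ih; have Ic : InnDer (c *: f + h) by apply: (InnDer_subspace A).2.
apply: gval_inj; rewrite gval_linear !gval_inF //.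
by congr (_, _, _); rewrite /= scaler0 addr0.
Qed.

Lemma InnDerZ c f : @InnDer _ A f -> InnDer (c *: f).
Proof.
move=> If; rewrite -[_ *: _]addr0.
by apply: (InnDer_subspace A).2 => //; apply: (InnDer_subspace A).1.
Qed.

Lemma InnDerD f h : @InnDer _ A f -> InnDer h -> InnDer (f + h).
Proof. by move=> If Ih; rewrite -[f]scale1r; apply: (InnDer_subspace A).2. Qed.

Lemma inFD f h : InnDer f -> InnDer h -> inF (f + h) = inF f + inF h.
Proof. by move=> If Ih; rewrite -[f]scale1r inF_linear // !scale1r. Qed.

Lemma inF0 : inF 0 = 0.
Proof. by rewrite -[0]/(innder_val (0 : innder A)) inFK. Qed.

Lemma inFZ c f : InnDer f -> inF (c *: f) = c *: inF f.
Proof.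
move=> If; rewrite -[c *: f]addr0 inF_linear ?inF0 ?addr0 //.
exact: (InnDer_subspace A).1.
Qed.

Lemma hdeg_inF i f : InnDer f -> fun_hdeg i f -> hdeg i (inF f).
Proof.
by move=> If hf; apply: hdeg_inD; rewrite /hdeg /= /innder_hdeg /= insubdIK.
Qed.

(** The generators of degree i span the elements of degree i: the components of
    a homogeneous tensor in a basis of the even spaces sl_2 and V are homogeneous
    of the same degree. *)
Lemma hdeg_gJM_ind i (P : g -> Prop) :
  P 0 -> (forall u v, P u -> P v -> P (u + v)) ->
  (forall x a, hdeg i a -> P (xJ x a)) ->
  (forall v m, hdeg i m -> P (vM v m)) ->
  (forall f, InnDer f -> fun_hdeg i f -> P (inF f)) ->
  forall u, hdeg i u -> P u.
Proof.
move=> P0 PD PJ PM PF [[X Q] d] [[hX hQ] hd] /=.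
have -> : (X, Q, d) = \sum_(k < \dim {: sl2 F}) xJ (vbasis {: sl2 F})`_k ((X : {ffun _ -> J}) k)
    + \sum_(k < \dim {: nat2 F}) vM (vbasis {: nat2 F})`_k ((Q : {ffun _ -> M}) k) + inD d.
  have JE (h : 'I_(\dim {: sl2 F}) -> tensor (sl2 F) J) :
    \sum_k ((h k, 0), 0) = ((\sum_k h k, 0), 0) :> g.
    by rewrite (big_morph (fun h => ((h, 0), 0) : g) (id1 := 0) (op1 := +%R)) //
      => u v; do ?congr pair; rewrite /= ?addr0.
  have ME (h : 'I_(\dim {: nat2 F}) -> tensor (nat2 F) M) :
    \sum_k ((0, h k), 0) = ((0, \sum_k h k), 0) :> g.
    by rewrite (big_morph (fun h => ((0, h), 0) : g) (id1 := 0) (op1 := +%R)) //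
      => u v; do ?congr pair; rewrite /= ?addr0.
  rewrite /xJ JE /vM ME -!tens_basis /inD.
  by do ?congr pair; rewrite /= ?addr0 ?add0r.
apply: (PD); first apply: (PD).
- by apply: big_ind => // k _; apply: PJ; apply: hX.
- by apply: big_ind => // k _; apply: PM; apply: hQ.
- by rewrite -inFK; apply: PF => //; apply: InnDer_val.
Qed.

Lemma hdeg_gJM_ext i (X : lmodType F) (f h : g -> X) :
  linear f -> linear h ->
  (forall x a, hdeg i a -> f (xJ x a) = h (xJ x a)) ->
  (forall v m, hdeg i m -> f (vM v m) = h (vM v m)) ->
  (forall d, InnDer d -> fun_hdeg i d -> f (inF d) = h (inF d)) ->
  forall u, hdeg i u -> f u = h u.
Proof.
move=> lf lh; apply: hdeg_gJM_ind => [|u v eu ev].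
  by rewrite (linear_eq0 lf) (linear_eq0 lh).
by rewrite (linear_add lf) (linear_add lh) eu ev.
Qed.

Lemma homogeneous_ext (V : superspace F) (X : lmodType F) (f h : V -> X) :
  linear f -> linear h -> (forall i v, hdeg i v -> f v = h v) -> f =1 h.
Proof.
move=> lf lh e v; rewrite [v]hcomp_sum (linear_add lf) (linear_add lh).
by rewrite !(e _ _ (hcompP _ _).1).
Qed.

Definition xJE := bilinearE xJ_bilinear.
Definition vME := bilinearE vM_bilinear.

End Generators.

(** * The bracket on generators *)

Section Bracket.
Variables (F : numFieldType) (A : ternary_superalgebra F).
Local Notation J := (tJ A).
Local Notation M := (tM A).
Local Notation g := (gJM A).
Local Notation "a *j b" := (@jmul _ J a b) (at level 40, left associativity).
Local Notation "a *@ m" := (@mact _ J M a m) (at level 40, left associativity).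
Local Notation "m ** n" := (@star _ A m n) (at level 40, left associativity).
Local Notation tau x y := (\tr (sl2_mx x *m sl2_mx y)).

Variable br : g -> g -> g.
Hypothesis Hbr : gJM_bracket br.

Definition brE := bilinearE (br_bilinear Hbr).

Lemma br_FF i j f h : InnDer f -> InnDer h -> fun_hdeg i f -> fun_hdeg j h ->
  br (inF f) (inF h) = inF (scomm (i * j) f h).
Proof.
move=> If Ih hf hh; apply: gval_inFP; first exact: InnDer_scomm.
rewrite (br_DD Hbr (i := i) (j := j)) /hdeg /= /innder_hdeg /= ?insubdIK //.
Qed.

Lemma br_FJ f x (a : J) : InnDer f -> br (inF f) (xJ x a) = xJ x (dJ f a).
Proof. by move=> If; rewrite br_DJ // insubdIK. Qed.

Lemma br_FM f v (m : M) : InnDer f -> br (inF f) (vM v m) = vM v (dM f m).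
Proof. by move=> If; rewrite br_DM // insubdIK. Qed.

Lemma br_JF i j f x (a : J) : InnDer f -> hdeg i a -> fun_hdeg j f ->
  br (xJ x a) (inF f) = - (-1) ^+ (i * j) *: xJ x (dJ f a).
Proof.
move=> If ha hf.
rewrite (br_anticomm Hbr (hdeg_xJ x ha) (hdeg_inF If hf)) br_FJ //.
by rewrite scaleNr.
Qed.

Lemma br_MF i j f v (m : M) : InnDer f -> hdeg i m -> fun_hdeg j f ->
  br (vM v m) (inF f) = - (-1) ^+ (i * j) *: vM v (dM f m).
Proof.
move=> If hm hf.
rewrite (br_anticomm Hbr (hdeg_vM v hm) (hdeg_inF If hf)) br_FM //.
by rewrite scaleNr.
Qed.

Lemma br_MJ i j x v (a : J) (m : M) : hdeg i m -> hdeg j a ->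
  br (vM v m) (xJ x a) = - (-1) ^+ (i * j) *: vM (sl2_nat x v) (a *@ m).
Proof.
move=> hm ha; rewrite (br_anticomm Hbr (hdeg_vM v hm) (hdeg_xJ x ha)).
by rewrite br_JM // scaleNr.
Qed.

Lemma br_xJ i j x y (a b : J) : hdeg i a -> hdeg j b ->
  br (xJ x a) (xJ y b)
  = xJ (sl2_br x y) (a *j b) + (2 * tau x y) *: inF (angle i j a b).
Proof.
move=> ha hb; have Iab := InnDer_angle ha hb; apply: gval_inj.
rewrite (br_JJ Hbr _ _ ha hb) addrC gval_linear gval_inF //.
have -> : 2^-1 * kappa x y = 2 * tau x y by rewrite /kappa; field.
by congr (_, _, _); rewrite /= ?scaler0 ?add0r ?addr0.
Qed.

Lemma br_vM i j v w (m n : M) : hdeg i m -> hdeg j n ->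
  br (vM v m) (vM w n)
  = xJ (odot v w) (m ** n) + det2 v w *: inF (partial i j m n).
Proof.
move=> hm hn; have Imn := InnDer_partial hm hn; apply: gval_inj.
rewrite (br_MM Hbr _ _ hm hn) addrC gval_linear gval_inF //.
by congr (_, _, _); rewrite /= ?scaler0 ?add0r ?addr0.
Qed.

Definition jacobi i j u v w :=
  br u (br v w) = br (br u v) w + (-1) ^+ (i * j) *: br v (br u w).

End Bracket.

(** * The Jacobi identity on generators *)

Section Jacobi.
Variables (F : numFieldType) (A : ternary_superalgebra F).
Local Notation J := (tJ A).
Local Notation M := (tM A).
Local Notation g := (gJM A).
Local Notation "a *j b" := (@jmul _ J a b) (at level 40, left associativity).
Local Notation "a *@ m" := (@mact _ J M a m) (at level 40, left associativity).
Local Notation "m ** n" := (@star _ A m n) (at level 40, left associativity).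
Local Notation tau x y := (\tr (sl2_mx x *m sl2_mx y)).

Variable br : g -> g -> g.
Hypothesis Hbr : gJM_bracket br.

Local Notation brE := (brE Hbr).
Local Notation jacobi := (jacobi br).

Lemma hdeg_scomm k l (f h : JM A -> JM A) :
  fun_hdeg k f -> fun_hdeg l h -> fun_hdeg (k (+) l) (scomm (k * l) f h).
Proof.
move=> hf hh j z hz; rewrite -[scomm _ _ _ _]/(f (h z) - _ *: h (f z)).
apply: hdegB; [|apply: hdegZ]; first by rewrite -addbA; apply: hf (hh _ _ hz).
by rewrite [k (+) l]addbC -addbA; apply: hh (hf _ _ hz).
Qed.

Section DerivationCases.
Variables (i : bool) (f : JM A -> JM A).
Hypotheses (If : InnDer f) (hf : fun_hdeg i f).
Let sf := superderivation_InnDer If hf.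

Lemma jacobi_DDD j k f' f'' :
  InnDer f' -> fun_hdeg j f' -> InnDer f'' -> fun_hdeg k f'' ->
  jacobi i j (inF f) (inF f') (inF f'').
Proof.
move=> If' hf' If'' hf''.
have I1 := InnDer_scomm If hf If' hf'; have h1 := hdeg_scomm hf hf'.
have I2 := InnDer_scomm If hf If'' hf''; have h2 := hdeg_scomm hf hf''.
have I3 := InnDer_scomm If' hf' If'' hf''; have h3 := hdeg_scomm hf' hf''.
rewrite /jacobi (br_FF Hbr If' If'' hf' hf'') (br_FF Hbr If If' hf hf').
rewrite (br_FF Hbr If If'' hf hf'') (br_FF Hbr If I3 hf h3).
rewrite (br_FF Hbr I1 If'' h1 hf'') (br_FF Hbr If' I2 hf' h2).
have I4 := InnDer_scomm If' hf' I2 h2; have I5 := InnDer_scomm I1 h1 If'' hf''.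
rewrite addrC -inF_linear //; congr inF; apply/funext => z.
pose sc s (p q : JM A -> JM A) z := p (q z) - (-1) ^+ s *: q (p z).
rewrite -[LHS]/(sc (i * (j (+) k))%N f (sc (j * k)%N f' f'') z).
rewrite -[RHS]/((-1) ^+ (i * j) *: sc (j * (i (+) k))%N f' (sc (i * k)%N f f'') z
  + sc ((i (+) j) * k)%N (sc (i * j)%N f f') f'' z) /sc.
rewrite !(linearE3 (InnDer_linear If)) !(linearE3 (InnDer_linear If')).
rewrite !(linearE3 (InnDer_linear If'')).
lmod.
Qed.

Lemma jacobi_DDJ j f' x a : InnDer f' -> fun_hdeg j f' ->
  jacobi i j (inF f) (inF f') (xJ x a).
Proof.
move=> If' hf'; have sf' := superderivation_InnDer If' hf'.
have I1 := InnDer_scomm If hf If' hf'.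
rewrite /jacobi (br_FF Hbr If If' hf hf') !br_FJ //.
by rewrite [dJ (scomm _ _ _) _]/dJ (scomm_inl _ _ sf sf') !xJE; lmod.
Qed.

Lemma jacobi_DDM j f' v m : InnDer f' -> fun_hdeg j f' ->
  jacobi i j (inF f) (inF f') (vM v m).
Proof.
move=> If' hf'; have sf' := superderivation_InnDer If' hf'.
have I1 := InnDer_scomm If hf If' hf'.
rewrite /jacobi (br_FF Hbr If If' hf hf') !br_FM //.
by rewrite [dM (scomm _ _ _) _]/dM (scomm_inr _ _ sf sf') !vME; lmod.
Qed.

(** The derivation rule for the product of J, and scomm_angle. *)
Lemma jacobi_DJJ j k x y (a b : J) : hdeg j a -> hdeg k b ->
  jacobi i j (inF f) (xJ x a) (xJ y b).
Proof.
move=> ha hb; have hda := hdeg_dJ sf ha; have hdb := hdeg_dJ sf hb.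
have Iab := InnDer_angle ha hb; have hab := angle_hdeg ha hb.
have I1 := InnDer_angle hda hb; have I2 := InnDer_angle ha hdb.
rewrite /jacobi (br_xJ Hbr _ _ ha hb) !brE !br_FJ // (br_FF Hbr If Iab hf hab).
rewrite (br_xJ Hbr _ _ hda hb) (br_xJ Hbr _ _ ha hdb) (sder_jmul sf ha hb).
rewrite (scomm_angle sf ha hb) inFD ?inFZ ?xJE //; last exact: InnDerZ.
lmod.
Qed.

Lemma jacobi_DJM j k x v (a : J) (m : M) : hdeg j a -> hdeg k m ->
  jacobi i j (inF f) (xJ x a) (vM v m).
Proof.
move=> ha hm; rewrite /jacobi !(br_FJ, br_FM, br_JM Hbr) //.
by rewrite (sder_mact sf ha hm) !vME; lmod.
Qed.

(** The derivation rule for star, and scomm_partial. *)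
Lemma jacobi_DMM j k v w (m n : M) : hdeg j m -> hdeg k n ->
  jacobi i j (inF f) (vM v m) (vM w n).
Proof.
move=> hm hn; have hdm := hdeg_dM sf hm; have hdn := hdeg_dM sf hn.
have Imn := InnDer_partial hm hn; have hmn := partial_hdeg hm hn.
have I1 := InnDer_partial hdm hn; have I2 := InnDer_partial hm hdn.
rewrite /jacobi (br_vM Hbr _ _ hm hn) !brE !br_FM // br_FJ //.
rewrite (br_FF Hbr If Imn hf hmn).
rewrite (br_vM Hbr _ _ hdm hn) (br_vM Hbr _ _ hm hdn) (sder_star sf hm hn).
rewrite (scomm_partial sf hm hn) inFD ?inFZ ?xJE //; last exact: InnDerZ.
lmod.
Qed.

End DerivationCases.

(** After the expansion of the brackets in sl_2, the coefficients of
    tr(xy) z, tr(xz) y and tr(yz) x amount to the definition of <., .> on J.  The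
    inner components all have tr(x[y, z]) as a coefficient up to sign, and are
    compared by angle_jmul_cyclic. *)
Lemma jacobi_JJJ i j k x y z (a b c : J) :
  hdeg i a -> hdeg j b -> hdeg k c ->
  jacobi i j (xJ x a) (xJ y b) (xJ z c).
Proof.
move=> ha hb hc; have hab := jmul_even ha hb; have hac := jmul_even ha hc.
have hbc := jmul_even hb hc.
have Iab := InnDer_angle ha hb; have hFab := angle_hdeg ha hb.
have Iac := InnDer_angle ha hc; have hFac := angle_hdeg ha hc.
have Ibc := InnDer_angle hb hc; have hFbc := angle_hdeg hb hc.
have I1 := InnDer_angle hab hc; have I2 := InnDer_angle hb hac.
rewrite /jacobi (br_xJ Hbr _ _ hb hc) (br_xJ Hbr _ _ ha hb).
rewrite (br_xJ Hbr _ _ ha hc) !brE (br_xJ Hbr _ _ ha hbc).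
rewrite (br_xJ Hbr _ _ hab hc) (br_xJ Hbr _ _ hb hac) (br_FJ Hbr) //.
rewrite (br_JF Hbr _ Ibc ha hFbc) (br_JF Hbr _ Iac hb hFac).
rewrite (angle_jmul_cyclic ha hb hc) -scaleNr inFD ?inFZ //; last exact: InnDerZ.
rewrite !sl2_br_br sl2_br_brl (trace_br_swap x y z) -trace_br.
rewrite (traceC y x) !dJ_angle (jmul_comm hc ha) (jmul_comm hb ha).
rewrite (jmul_comm hc hb) (jmul_comm hab hc) !jmulE !xJE.
lmod.
Qed.

(** The part in [x, y] v is the axiom of special modules and the part in
    tr(xy) v is the definition of <a, b> on M. *)
Lemma jacobi_JJM i j k x y v (a b : J) (m : M) :
  hdeg i a -> hdeg j b -> hdeg k m ->
  jacobi i j (xJ x a) (xJ y b) (vM v m).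
Proof.
move=> ha hb hm; have Iab := InnDer_angle ha hb.
rewrite /jacobi (br_xJ Hbr _ _ ha hb) !brE !(br_JM Hbr) (br_FM Hbr) //.
rewrite (mact_special _ ha hb) dM_angle !(nat_nat y x) !(nat_nat x y).
rewrite (sl2_brC y x) (traceC y x) !(bilinearE (@sl2_nat_bilinear F)) !vME.
lmod.
Qed.

(** The invariance of odot and det under sl_2 reduces the first component to
    terms in xv odot w and v odot xw, as det(v, w) x is their difference up to
    sign; the second one has det(xv, w) as a common factor. *)
Lemma jacobi_JMM i j k x v w (a : J) (m n : M) :
  hdeg i a -> hdeg j m -> hdeg k n ->
  jacobi i j (xJ x a) (vM v m) (vM w n).
Proof.
move=> ha hm hn; have ham := mact_even ha hm; have han := mact_even ha hn.
have hs := star_even hm hn.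
have Imn := InnDer_partial hm hn; have hFmn := partial_hdeg hm hn.
have I1 := InnDer_partial ham hn; have I2 := InnDer_partial hm han.
rewrite /jacobi (br_vM Hbr _ _ hm hn) !brE !(br_JM Hbr).
rewrite (br_xJ Hbr _ _ ha hs) (br_JF Hbr _ Imn ha hFmn).
rewrite (br_vM Hbr _ _ ham hn) (br_vM Hbr _ _ hm han) trace_odot.
rewrite (angle_star_partial ha hm hn) inFZ; last first.
  by rewrite -scaleNr; apply: InnDerD => //; apply: InnDerZ.
rewrite -scaleNr inFD ?inFZ //; last exact: InnDerZ.
have -> Z : det2 v w *: (- (-1) ^+ (i * (j (+) k)) *: xJ x Z)
  = (-1) ^+ (i * (j (+) k)) *: (xJ (odot (sl2_nat x v) w) Z
                                - xJ (odot v (sl2_nat x w)) Z).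
  by rewrite -!xJE odot_skew !xJE; lmod.
rewrite odot_equivariant (SJT1 ha hm hn) (dJ_partial _ _ _ _ ha).
rewrite (det2_invariant x v w) !xJE.
lmod.
Qed.

(** Once u is eliminated from all terms by det2_cyclic, the coefficients of v
    and w are combinations of triple products that are brought to the order
    m, n, r by SJT3 and triple_swap23. *)
Lemma jacobi_MMM i j k v w u (m n r : M) :
  hdeg i m -> hdeg j n -> hdeg k r ->
  jacobi i j (vM v m) (vM w n) (vM u r).
Proof.
move=> hm hn hr; have hmn := star_even hm hn; have hmr := star_even hm hr.
have hnr := star_even hn hr.
have Imn := InnDer_partial hm hn; have hFmn := partial_hdeg hm hn.
have Imr := InnDer_partial hm hr; have hFmr := partial_hdeg hm hr.
have Inr := InnDer_partial hn hr; have hFnr := partial_hdeg hn hr.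
rewrite /jacobi (br_vM Hbr _ _ hm hn) (br_vM Hbr _ _ hn hr).
rewrite (br_vM Hbr _ _ hm hr) !brE (br_FM Hbr) // !(br_JM Hbr).
rewrite (br_MJ Hbr _ _ hm hnr) (br_MJ Hbr _ _ hn hmr).
rewrite (br_MF Hbr _ Inr hm hFnr) (br_MF Hbr _ Imr hn hFmr).
rewrite (odot_nat v w u) (odot_nat2 v w u) (odot_nat2 w v u).
have -> Z : det2 v w *: vM u Z = det2 v u *: vM w Z - det2 w u *: vM v Z :> g.
  by have := congr1 (fun t => vM t Z : g) (det2_cyclic v w u); rewrite !vME.
rewrite !dM_partial (SJT3 hn hr hm) (triple_swap23 hm hn hr).
rewrite (star_anticomm hn hm) !operationE !vME.
lmod.
Qed.

End Jacobi.

(** * The Jacobi identity in general *)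

(** The natural number records the kind of generator; it serves to sort the
    arguments of the Jacobi identity. *)
Inductive generator (F : numFieldType) (A : ternary_superalgebra F) (i : bool) :
  nat -> gJM A -> Prop :=
| GeneratorD (f : JM A -> JM A) of InnDer f & fun_hdeg i f : generator i 0 (inF f)
| GeneratorJ x a of hdeg i a : generator i 1 (xJ x a)
| GeneratorM v m of hdeg i m : generator i 2 (vM v m).

Section ShortLie.
Variables (F : numFieldType) (A : ternary_superalgebra F).
Local Notation J := (tJ A).
Local Notation M := (tM A).
Local Notation g := (gJM A).

Variable br : g -> g -> g.
Hypothesis Hbr : gJM_bracket br.
Local Notation brE := (brE Hbr).
Local Notation jacobi := (jacobi br).


Lemma generator_hdeg i t u : generator i t u -> hdeg i (u : g).
Proof. by case=> *; [apply: hdeg_inF|apply: hdeg_xJ|apply: hdeg_vM]. Qed.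

Lemma hdeg_generator_ext i (X : lmodType F) (f h : g -> X) :
  linear f -> linear h -> (forall t u, generator i t u -> f u = h u) ->
  forall u, hdeg i u -> f u = h u.
Proof.
move=> lf lh e; apply: hdeg_gJM_ext => // [x a ha|v m hm|d Id hd];
  by apply: e; constructor.
Qed.

(** Super-anticommutativity turns the identity for (u, v, w) into the one for
    (v, u, w), multiplied by a sign. *)
Lemma jacobi_swap12 i j k u v w : hdeg i u -> hdeg j v -> hdeg k w ->
  jacobi i j u v w -> jacobi j i v u w.
Proof.
rewrite /jacobi => hu hv hw E; rewrite (br_anticomm Hbr hv hu) !brE.
apply: (linear_combination1 (c := - (-1) ^+ (i * j)) E); lmod.
Qed.

Hypothesis br_even : forall i j u v,
  hdeg i u -> hdeg j v -> hdeg (i (+) j) (br u v).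

Lemma jacobi_swap23 i j k u v w : hdeg i u -> hdeg j v -> hdeg k w ->
  jacobi i j u v w -> jacobi i k u w v.
Proof.
rewrite /jacobi => hu hv hw E; have huv := br_even hu hv.
rewrite (br_anticomm Hbr hw hv) (br_anticomm Hbr (br_even hu hw) hv).
rewrite (br_anticomm Hbr hw huv) !brE.
apply: (linear_combination1 (c := - (-1) ^+ (j * k)) E); lmod.
Qed.

Lemma jacobi_sorted i j k t1 t2 t3 u v w : (t1 <= t2)%N -> (t2 <= t3)%N ->
  generator i t1 u -> generator j t2 v -> generator k t3 w ->
  jacobi i j u v w.
Proof.
move=> t12 t23 gu gv gw; move: t12 t23.
case: gu => [f If hf|x a ha|p m hm]; case: gv => [f' If' hf'|y b hb|q n hn] //;
  case: gw => [f'' If'' hf''|z c hc|r s hs] // _ _.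
- exact: jacobi_DDD If'' hf''.
- exact: jacobi_DDJ.
- exact: jacobi_DDM.
- exact: jacobi_DJJ hb hc.
- exact: jacobi_DJM hb hs.
- exact: jacobi_DMM hn hs.
- exact: jacobi_JJJ ha hb hc.
- exact: jacobi_JJM ha hb hs.
- exact: jacobi_JMM ha hn hs.
- exact: jacobi_MMM hm hn hs.
Qed.

Lemma jacobi_generator i j k t1 t2 t3 u v w :
  generator i t1 u -> generator j t2 v -> generator k t3 w ->
  jacobi i j u v w.
Proof.
move=> gu gv gw; have S := jacobi_sorted.
have hu := generator_hdeg gu; have hv := generator_hdeg gv.
have hw := generator_hdeg gw.
case: (leqP t1 t2) => [t12|/ltnW t21]; case: (leqP t2 t3) => [t23|/ltnW t32];
  case: (leqP t1 t3) => [t13|/ltnW t31].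
- exact: S gu gv gw.
- exact: S gu gv gw.
- by apply: (jacobi_swap23 hu hw hv); apply: S gu gw gv.
- apply: (jacobi_swap23 hu hw hv); apply: (jacobi_swap12 hw hu hv).
  exact: S gw gu gv.
- by apply: (jacobi_swap12 hv hu hw); apply: S gv gu gw.
- apply: (jacobi_swap12 hv hu hw); apply: (jacobi_swap23 hv hw hu).
  exact: S gv gw gu.
- by apply: (jacobi_swap12 hv hu hw); apply: S gv gu gw.
- apply: (jacobi_swap12 hv hu hw); apply: (jacobi_swap23 hv hw hu).
  by apply: (jacobi_swap12 hw hv hu); apply: S gw gv gu.
Qed.

Lemma jacobi_hdeg i j k u v w : hdeg i u -> hdeg j v -> hdeg k w ->
  jacobi i j u v w.
Proof.
move=> hu hv hw; rewrite /jacobi; move: u hu.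
apply: hdeg_generator_ext => [c p q|c p q|t u gu]; rewrite ?brE; try lmod.
move: v hv; apply: hdeg_generator_ext => [c p q|c p q|t' v gv];
  rewrite ?brE; try lmod.
move: w hw; apply: hdeg_generator_ext => [c p q|c p q|t'' w gw];
  rewrite ?brE; try lmod.
exact: jacobi_generator gu gv gw.
Qed.

End ShortLie.

(** * The action of sl_2, and uniqueness of the bracket *)

Section ShortStructure.
Variables (F : numFieldType) (A : ternary_superalgebra F).
Local Notation J := (tJ A).
Local Notation M := (tM A).
Local Notation g := (gJM A).

Lemma gJM_act_linear x : linear (@gJM_act _ A x).
Proof.
have [br_r _] := @sl2_br_bilinear F; have [nat_r _] := @sl2_nat_bilinear F.
have [lb _] := tens_mapE J (br_r x); have [ln _] := tens_mapE M (nat_r x).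
move=> c u v; rewrite /gJM_act /short_act /= lb ln.
by congr pair; rewrite /= ?scaler0 ?addr0.
Qed.

Lemma gJM_act_xJ x y (a : J) : gJM_act x (xJ y a : g) = xJ (sl2_br x y) a.
Proof.
have [br_r _] := @sl2_br_bilinear F; have [nat_r _] := @sl2_nat_bilinear F.
have [lb eb] := tens_mapE J (br_r x); have [ln _] := tens_mapE M (nat_r x).
by rewrite /gJM_act /short_act /= eb (linear_eq0 ln).
Qed.

Lemma gJM_act_vM x v (m : M) : gJM_act x (vM v m : g) = vM (sl2_nat x v) m.
Proof.
have [br_r _] := @sl2_br_bilinear F; have [nat_r _] := @sl2_nat_bilinear F.
have [lb _] := tens_mapE J (br_r x); have [ln en] := tens_mapE M (nat_r x).
by rewrite /gJM_act /short_act /= en (linear_eq0 lb).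
Qed.

Lemma gJM_act_inF x f : gJM_act x (inF f : g) = 0.
Proof.
have [br_r _] := @sl2_br_bilinear F; have [nat_r _] := @sl2_nat_bilinear F.
have [lb _] := tens_mapE J (br_r x); have [ln _] := tens_mapE M (nat_r x).
by rewrite /gJM_act /short_act /= (linear_eq0 lb) (linear_eq0 ln).
Qed.

Definition actE x := linearE3 (gJM_act_linear x).

Lemma gJM_generator_ext (X : lmodType F) (f h : g -> X) :
  linear f -> linear h -> (forall i t u, generator i t u -> f u = h u) ->
  f =1 h.
Proof.
move=> lf lh e; apply: homogeneous_ext => // i; apply: hdeg_generator_ext => // t.
exact: e.
Qed.

Lemma gJM_act_bilinear : bilinear_map (@gJM_act _ A).
Proof.
split=> [|u c x y]; first exact: gJM_act_linear.
have [_ brl] := @sl2_br_bilinear F; have [_ natl] := @sl2_nat_bilinear F.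
move: u; apply: gJM_generator_ext => [d p q|d p q|i t u].
- exact: gJM_act_linear.
- by rewrite !actE; lmod.
- case=> [f If hf|z a ha|v m hm].
  + by rewrite !gJM_act_inF scaler0 addr0.
  + by rewrite !gJM_act_xJ [sl2_br _ _]brl !xJE.
  + by rewrite !gJM_act_vM [sl2_nat _ _]natl !vME.
Qed.

Lemma gJM_act_br x y (u : g) : gJM_act (sl2_br x y) u
  = gJM_act x (gJM_act y u) - gJM_act y (gJM_act x u).
Proof.
move: u; apply: gJM_generator_ext => [c p q|c p q|i t u].
- exact: gJM_act_linear.
- by rewrite !actE; lmod.
- case=> [f If hf|z a ha|v m hm].
  + by rewrite !gJM_act_inF !actE subrr.
  + by rewrite !gJM_act_xJ (sl2_jacobi x y z) !xJE addrK.
  + by rewrite !gJM_act_vM sl2_br_nat !vME.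
Qed.

Lemma gJM_act_even x i (u : g) : hdeg i u -> hdeg i (gJM_act x u).
Proof.
move: u; apply: hdeg_gJM_ind => [|u v hu hv|y a ha|v m hm|f If hf].
- by rewrite actE; apply: hdeg0.
- by rewrite actE; apply: hdegD.
- by rewrite gJM_act_xJ; apply: hdeg_xJ.
- by rewrite gJM_act_vM; apply: hdeg_vM.
- by rewrite gJM_act_inF; apply: hdeg0.
Qed.

Section Bracket.
Variable br : g -> g -> g.
Hypothesis Hbr : gJM_bracket br.
Local Notation brE := (brE Hbr).

(** A relation between two elements that is supersymmetric need only be checked
    for sorted pairs of generators. *)
Lemma generator_swap (P : bool -> bool -> g -> g -> Prop) :
  (forall i j t t' u v, (t <= t')%N -> generator i t u -> generator j t' v ->
     P i j u v) ->
  (forall i j u v, hdeg i u -> hdeg j v -> P i j u v -> P j i v u) ->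
  forall i j t t' u v, generator i t u -> generator j t' v -> P i j u v.
Proof.
move=> Ps Pc i j t t' u v gu gv; case: (leqP t t') => [le|/ltnW le].
  exact: Ps le gu gv.
by apply: Pc (generator_hdeg gv) (generator_hdeg gu) _; apply: Ps le gv gu.
Qed.

Lemma br_even i j u v : hdeg i u -> hdeg j v -> hdeg (i (+) j) (br u v).
Proof.
have gen i' j' t t' u' v' : generator i' t u' -> generator j' t' v' ->
    hdeg (i' (+) j') (br u' v').
  apply: (generator_swap (P := fun i j u v => hdeg (i (+) j) (br u v))).
    move=> {}i {}j {}t {}t' {}u {}v le gu gv; move: le.
    case: gu => [f If hf|x a ha|p m hm]; case: gv => [f' If' hf'|y b hb|q n hn] //.
    - rewrite (br_FF Hbr If If' hf hf') => _.
      by apply: hdeg_inF (InnDer_scomm If hf If' hf') (hdeg_scomm hf hf').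
    - rewrite (br_FJ Hbr) // => _; apply: hdeg_xJ.
      exact: (hdeg_dJ (superderivation_InnDer If hf) hb).
    - rewrite (br_FM Hbr) // => _; apply: hdeg_vM.
      exact: (hdeg_dM (superderivation_InnDer If hf) hn).
    - rewrite (br_xJ Hbr _ _ ha hb) => _; apply: hdegD.
        exact: hdeg_xJ (jmul_even ha hb).
      exact/hdegZ/(hdeg_inF (InnDer_angle ha hb))/angle_hdeg.
    - by rewrite (br_JM Hbr) => _; apply: hdeg_vM (mact_even ha hn).
    - rewrite (br_vM Hbr _ _ hm hn) => _; apply: hdegD.
        exact: hdeg_xJ (star_even hm hn).
      exact/hdegZ/(hdeg_inF (InnDer_partial hm hn))/partial_hdeg.
  move=> {}i {}j {}u {}v hu hv h; rewrite (br_anticomm Hbr hv hu) addbC.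
  by rewrite -scaleN1r; do 2 apply: hdegZ.
have ext (h : g -> g) i' k : (forall u v, h (u + v) = h u + h v) -> h 0 = 0 ->
    (forall t u, generator i' t u -> hdeg k (h u)) ->
    forall u, hdeg i' u -> hdeg k (h u).
  move=> hD h0 hg; apply: hdeg_gJM_ind => [|u' v' hu hv|x a ha|p m hm|f If hf].
  - by rewrite h0; apply: hdeg0.
  - by rewrite hD; apply: hdegD.
  - by apply: (hg 1%N); constructor.
  - by apply: (hg 2%N); constructor.
  - by apply: (hg 0%N); constructor.
move=> hu hv; apply: (ext (br^~ v)) hu => [p q||t {}u gu]; rewrite ?brE //.
by apply: (ext (br u)) hv => [p q||t' {}v gv]; rewrite ?brE //; apply: gen gu gv.
Qed.

Lemma br_lie : lie_superalgebra br.
Proof.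
split.
- exact: br_bilinear Hbr.
- exact: br_even.
- exact: br_anticomm Hbr.
- by move=> i j k u v w; apply: (jacobi_hdeg Hbr br_even).
Qed.

Lemma gJM_act_der x u v :
  gJM_act x (br u v) = br (gJM_act x u) v + br u (gJM_act x v).
Proof.
pose P (_ _ : bool) u v := gJM_act x (br u v) = br (gJM_act x u) v + br u (gJM_act x v).
have gen : forall i j t t' u v, generator i t u -> generator j t' v -> P i j u v.
  apply: generator_swap; rewrite /P.
    move=> {P} i j t t' {}u {}v le gu gv; move: le.
    case: gu => [f If hf|y a ha|p m hm]; case: gv => [f' If' hf'|z b hb|q n hn] // _.
    - by rewrite (br_FF Hbr If If' hf hf') !gJM_act_inF !brE addr0.
    - by rewrite (br_FJ Hbr) // gJM_act_inF !gJM_act_xJ brE (br_FJ Hbr) // add0r.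
    - by rewrite (br_FM Hbr) // gJM_act_inF !gJM_act_vM brE (br_FM Hbr) // add0r.
    - rewrite (br_xJ Hbr _ _ ha hb) !actE !gJM_act_xJ gJM_act_inF.
      rewrite !(br_xJ Hbr _ _ ha hb) (sl2_jacobi x y z) (trace_br_swap x y z) -trace_br !xJE.
      lmod.
    - rewrite (br_JM Hbr) !gJM_act_xJ !gJM_act_vM !(br_JM Hbr) -!vME.
      by rewrite sl2_br_nat subrK.
    - rewrite (br_vM Hbr _ _ hm hn) !actE gJM_act_xJ !gJM_act_vM gJM_act_inF.
      rewrite !(br_vM Hbr _ _ hm hn) odot_equivariant det2_invariant !xJE.
      lmod.
  move=> {P} i j {}u {}v hu hv E; have hxu := gJM_act_even x hu.
  have hxv := gJM_act_even x hv; rewrite (br_anticomm Hbr hv hu) !actE E.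
  rewrite (br_anticomm Hbr hxv hu) (br_anticomm Hbr hv hxu); lmod.
move: u; apply: gJM_generator_ext => [c p q|c p q|i t u gu]; rewrite ?(brE, actE);
  try lmod.
move: v; apply: gJM_generator_ext => [c p q|c p q|j t' v gv]; rewrite ?(brE, actE);
  try lmod.
exact: gen gu gv.
Qed.

Lemma br_short : short_sl2_lie_superalgebra br (@gJM_act _ A).
Proof.
split.
- exact: br_lie.
- exact: gJM_act_bilinear.
- exact: gJM_act_br.
- by move=> x i u; apply: gJM_act_even.
- exact: gJM_act_der.
- by exists J, M, (innder A), id; split=> //; exists id.
Qed.

Lemma gJM_bracket_unique br' : gJM_bracket br' -> br = br'.
Proof.
move=> Hbr'; pose P (_ _ : bool) u v := br u v = br' u v.
have gen : forall i j t t' u v, generator i t u -> generator j t' v -> P i j u v.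
  apply: generator_swap; rewrite /P.
    move=> {P} i j t t' u v le gu gv; move: le.
    case: gu => [f If hf|y a ha|p m hm]; case: gv => [f' If' hf'|z b hb|q n hn] // _.
    - by rewrite (br_FF Hbr If If' hf hf') (br_FF Hbr' If If' hf hf').
    - by rewrite (br_FJ Hbr) // (br_FJ Hbr').
    - by rewrite (br_FM Hbr) // (br_FM Hbr').
    - by rewrite (br_xJ Hbr _ _ ha hb) (br_xJ Hbr' _ _ ha hb).
    - by rewrite (br_JM Hbr) (br_JM Hbr').
    - by rewrite (br_vM Hbr _ _ hm hn) (br_vM Hbr' _ _ hm hn).
  move=> {P} i j u v hu hv E.
  by rewrite (br_anticomm Hbr hv hu) E (br_anticomm Hbr' hv hu).
have [r l] := br_bilinear Hbr; have [r' l'] := br_bilinear Hbr'.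
apply/funext => u; apply/funext => v.
move: u; apply: gJM_generator_ext => // i t u gu.
by move: v; apply: gJM_generator_ext => // j t' v gv; apply: gen gu gv.
Qed.

End Bracket.
End ShortStructure.

(** * Extension of bilinear data to tensor products *)

Lemma linear_sumE (F : fieldType) (V W : lmodType F) (f : V -> W) :
  linear f -> forall (I : finType) (h : I -> V),
  f (\sum_i h i) = \sum_i f (h i).
Proof. by move=> lf I h; rewrite (big_morph f (linear_add lf) (linear_eq0 lf)). Qed.

Section TensorBilinear.
Variables (F : fieldType) (U U' : vectType F) (S T : superspace F).
Variables (Z1 Z2 Z : lmodType F).
Variables (beta : U -> U' -> Z1) (gamma : S -> T -> Z2) (mu : Z1 -> Z2 -> Z).
Hypotheses (Hbeta : bilinear_map beta) (Hgamma : bilinear_map gamma).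
Hypothesis (Hmu : bilinear_map mu).

(** The bilinear map that sends (u (x) s, u' (x) t) to
    mu (beta u u') (gamma s t), written in the bases of U and U' on which the
    model of the tensor products relies. *)
Definition tens_lift2 (X : tensor U S) (Y : tensor U' T) : Z :=
  \sum_(k < \dim {: U}) \sum_(l < \dim {: U'})
    mu (beta (vbasis {: U})`_k (vbasis {: U'})`_l)
       (gamma ((X : {ffun _ -> S}) k) ((Y : {ffun _ -> T}) l)).

Lemma tens_lift2_bilinear : bilinear_map tens_lift2.
Proof.
split=> [X|Y] c P Q; rewrite /tens_lift2 scaler_sumr -big_split;
  apply: eq_bigr => k _; rewrite /= scaler_sumr -big_split;
  apply: eq_bigr => l _.
  by rewrite !ffunE !(bilinearE Hgamma) !(bilinearE Hmu).
by rewrite !ffunE !(bilinearE Hgamma) !(bilinearE Hmu).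
Qed.

Lemma tens_lift2E u u' s t :
  tens_lift2 (tens u s) (tens u' t) = mu (beta u u') (gamma s t).
Proof.
rewrite [in RHS](coord_vbasis (memvf u)) [in RHS](coord_vbasis (memvf u')).
have sumM (I : finType) (h : I -> Z1) z :
    mu (\sum_i h i) z = \sum_i mu (h i) z by exact: (linear_sumE (Hmu.2 z) h).
have sumL (I : finType) (h : I -> U) w :
    beta (\sum_i h i) w = \sum_i beta (h i) w by exact: (linear_sumE (Hbeta.2 w) h).
have sumR (I : finType) (h : I -> U') w :
    beta w (\sum_i h i) = \sum_i beta w (h i) by exact: (linear_sumE (Hbeta.1 w) h).
rewrite sumL sumM; apply: eq_bigr => k _; rewrite sumR sumM.
apply: eq_bigr => l _; rewrite !ffunE.
by rewrite !(bilinearE Hgamma, bilinearE Hbeta) !(bilinearE Hmu).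
Qed.

End TensorBilinear.

Section Construction.
Variables (F : numFieldType) (A : ternary_superalgebra F).
Local Notation J := (tJ A).
Local Notation M := (tM A).
Local Notation g := (gJM A).
Local Notation End_JM := (JM A -> JM A).

Lemma scale_bilinear :
  @bilinear_map F F^o End_JM End_JM (fun (c : F) (f : End_JM) => c *: f).
Proof.
split=> [k|f] c u v; first by rewrite scalerDr !scalerA mulrC.
by rewrite scalerDl scalerA.
Qed.

Lemma half_kappa_bilinear :
  @bilinear_map F (sl2 F) (sl2 F) F^o (fun x y => 2^-1 * kappa x y).
Proof.
have E := bilinearE (@trace_form_bilinear F).
by split=> [x|y] k u v; rewrite /kappa !E -[RHS]/(k * _ + _) -[k *: _]/(k * _); ring.
Qed.

Lemma angle_bilinear i j : bilinear_map (fun a b : J => @angle _ A i j a b).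
Proof.
split=> [a|b] c p q; apply/funext => z; apply: injective_projections => /=;
  rewrite !operationE; lmod.
Qed.

Lemma partial_bilinear i j : bilinear_map (fun m n : M => @partial _ A i j m n).
Proof.
split=> [a|b] c p q; apply/funext => z; apply: injective_projections => /=;
  rewrite ?big_bool /= !operationE; lmod.
Qed.

Definition tens_dJ (d : innder A) (Y : tensor (sl2 F) J) : tensor (sl2 F) J :=
  [ffun k => dJ (innder_val d) ((Y : {ffun _ -> J}) k)].
Definition tens_dM (d : innder A) (Y : tensor (nat2 F) M) : tensor (nat2 F) M :=
  [ffun k => dM (innder_val d) ((Y : {ffun _ -> M}) k)].

Lemma tens_dJ_bilinear : bilinear_map tens_dJ.
Proof.
split=> [d|Y] c u v; apply/ffunP => k; rewrite !ffunE.
  exact: linear_dJ (InnDer_linear (InnDer_val d)) _ _ _.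
by rewrite innder_val_linear.
Qed.

Lemma tens_dM_bilinear : bilinear_map tens_dM.
Proof.
split=> [d|Y] c u v; apply/ffunP => k; rewrite !ffunE.
  exact: linear_dM (InnDer_linear (InnDer_val d)) _ _ _.
by rewrite innder_val_linear.
Qed.

Lemma tens_dJE d x a : tens_dJ d (tens x a) = tens x (dJ (innder_val d) a).
Proof.
apply/ffunP => k; rewrite !ffunE.
by rewrite (linearE3 (linear_dJ (InnDer_linear (InnDer_val d)))).
Qed.

Lemma tens_dME d v m : tens_dM d (tens v m) = tens v (dM (innder_val d) m).
Proof.
apply/ffunP => k; rewrite !ffunE.
by rewrite (linearE3 (linear_dM (InnDer_linear (InnDer_val d)))).
Qed.

Lemma scomm_bilinear s :
  bilinear_map (fun d d' : innder A => scomm s (innder_val d) (innder_val d')).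
Proof.
split=> [d|d'] c u v; apply/funext => z; rewrite !innder_val_linear.
  have E := linearE3 (InnDer_linear (InnDer_val d)).
  pose sc (f h : End_JM) := f (h z) - (-1) ^+ s *: h (f z).
  rewrite -[LHS]/(sc (innder_val d) (c *: innder_val u + innder_val v)).
  rewrite -[RHS]/(c *: sc (innder_val d) (innder_val u)
                  + sc (innder_val d) (innder_val v)) /sc.
  rewrite -![(c *: innder_val u + innder_val v) _]/(c *: innder_val u _ + innder_val v _).
  by rewrite !E; lmod.
have E := linearE3 (InnDer_linear (InnDer_val d')).
pose sc (f h : End_JM) := f (h z) - (-1) ^+ s *: h (f z).
rewrite -[LHS]/(sc (c *: innder_val u + innder_val v) (innder_val d')).
rewrite -[RHS]/(c *: sc (innder_val u) (innder_val d')
                + sc (innder_val v) (innder_val d')) /sc.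
rewrite -![(c *: innder_val u + innder_val v) _]/(c *: innder_val u _ + innder_val v _).
by rewrite !E; lmod.
Qed.

End Construction.

(** * Existence of the bracket *)

(** The sign of super-anticommutativity, applied twice, is trivial. *)
Lemma koszul_sign_cancel (F : numFieldType) (V : lmodType F) (i j : bool) (x : V) :
  x = - ((-1) ^+ (i * j) *: (- (-1) ^+ (j * i) *: x)).
Proof. lmod. Qed.

Section BracketConstruction.
Variables (F : numFieldType) (A : ternary_superalgebra F).
Local Notation J := (tJ A).
Local Notation M := (tM A).
Local Notation g := (gJM A).
Local Notation End_JM := (JM A -> JM A).
Local Notation ambient := (tensor (sl2 F) J * tensor (nat2 F) M * End_JM)%type.

Definition bracketJJ := tens_lift2 (@sl2_br F) (@jmul _ J) (@tens _ (sl2 F) J).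
Definition bracketJJ_inner i j := @tens_lift2 F (sl2 F) (sl2 F) J J F^o End_JM End_JM
  (fun x y => 2^-1 * kappa x y) (@angle _ A i j) (fun (c : F) f => c *: f).
Definition bracketJM := tens_lift2 (@sl2_nat F) (@mact _ J M) (@tens _ (nat2 F) M).
Definition bracketMM := tens_lift2 (@odot F) (@star _ A) (@tens _ (sl2 F) J).
Definition bracketMM_inner i j :=
  @tens_lift2 F (nat2 F) (nat2 F) M M F^o End_JM End_JM
  (@det2 F) (@partial _ A i j) (fun (c : F) f => c *: f).

Definition bracketDD s (d d' : innder A) := scomm s (innder_val d) (innder_val d').

(** The formulas of the bracket, with the signs that are right for u of degree i
    and v of degree j, and with last component in End(J (+) M).  In this form they
    are bilinear in u and v, for fixed i and j. *)
Definition graded_bracket (i j : bool) (u v : g) : ambient :=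
  (bracketJJ u.1.1 v.1.1 + bracketMM u.1.2 v.1.2
     + tens_dJ u.2 v.1.1 - (-1) ^+ (i * j) *: tens_dJ v.2 u.1.1,
   bracketJM u.1.1 v.1.2 - (-1) ^+ (i * j) *: bracketJM v.1.1 u.1.2
     + tens_dM u.2 v.1.2 - (-1) ^+ (i * j) *: tens_dM v.2 u.1.2,
   bracketJJ_inner i j u.1.1 v.1.1 + bracketMM_inner i j u.1.2 v.1.2
     + bracketDD (i * j) u.2 v.2).

Lemma bracketJJ_bilinear : bilinear_map bracketJJ.
Proof. by apply: tens_lift2_bilinear (jmul_bilinear J) (tens_bilinear _ _). Qed.
Lemma bracketJJ_inner_bilinear i j : bilinear_map (bracketJJ_inner i j).
Proof. exact: tens_lift2_bilinear (angle_bilinear A i j) (scale_bilinear A). Qed.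
Lemma bracketJM_bilinear : bilinear_map bracketJM.
Proof. by apply: tens_lift2_bilinear (mact_bilinear M) (tens_bilinear _ _). Qed.
Lemma bracketMM_bilinear : bilinear_map bracketMM.
Proof. by apply: tens_lift2_bilinear (star_bilinear A) (tens_bilinear _ _). Qed.
Lemma bracketMM_inner_bilinear i j : bilinear_map (bracketMM_inner i j).
Proof. exact: tens_lift2_bilinear (partial_bilinear A i j) (scale_bilinear A). Qed.

Lemma bracketJJE x y a b : bracketJJ (tens x a) (tens y b) = tens (sl2_br x y) (jmul a b).
Proof.
exact: (tens_lift2E (sl2_br_bilinear F) (jmul_bilinear J) (tens_bilinear _ _)).
Qed.
Lemma bracketJME x v a m : bracketJM (tens x a) (tens v m) = tens (sl2_nat x v) (mact a m).
Proof.
exact: (tens_lift2E (sl2_nat_bilinear F) (mact_bilinear M) (tens_bilinear _ _)).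
Qed.
Lemma bracketMME v w m n : bracketMM (tens v m) (tens w n) = tens (odot v w) (star m n).
Proof.
exact: (tens_lift2E (odot_bilinear F) (star_bilinear A) (tens_bilinear _ _)).
Qed.
Lemma bracketJJ_innerE i j x y a b : bracketJJ_inner i j (tens x a) (tens y b)
  = (2^-1 * kappa x y) *: angle i j a b.
Proof.
exact: (tens_lift2E (half_kappa_bilinear F) (angle_bilinear A i j)
  (scale_bilinear A)).
Qed.
Lemma bracketMM_innerE i j v w m n : bracketMM_inner i j (tens v m) (tens w n)
  = det2 v w *: partial i j m n.
Proof.
exact: (tens_lift2E (det2_bilinear F) (partial_bilinear A i j)
  (scale_bilinear A)).
Qed.

Lemma bracketDD_bilinear s : bilinear_map (bracketDD s).
Proof. exact: scomm_bilinear. Qed.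

Definition pieceE := (bilinearE bracketJJ_bilinear, bilinearE bracketJM_bilinear,
  bilinearE bracketMM_bilinear, fun i j => bilinearE (bracketJJ_inner_bilinear i j),
  fun i j => bilinearE (bracketMM_inner_bilinear i j),
  bilinearE (@tens_dJ_bilinear _ A), bilinearE (@tens_dM_bilinear _ A),
  fun s => bilinearE (bracketDD_bilinear s)).

Lemma graded_bracket_bilinear i j : bilinear_map (graded_bracket i j).
Proof.
split=> [u c v w|v c u w]; rewrite /graded_bracket; congr (_, _, _) => /=;
  rewrite !pieceE; lmod.
Qed.


Definition graded_bracketE i j := bilinearE (graded_bracket_bilinear i j).

Lemma graded_JJ i j x y a b : graded_bracket i j (xJ x a) (xJ y b)
  = (tens (sl2_br x y) (jmul a b), 0, (2^-1 * kappa x y) *: angle i j a b).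
Proof.
rewrite /graded_bracket /= bracketJJE bracketJJ_innerE !pieceE.
by rewrite ?(scaler0, subr0, oppr0, addr0, add0r, sub0r, scaleNr).
Qed.

Lemma graded_JM i j x v a m : graded_bracket i j (xJ x a) (vM v m)
  = (0, tens (sl2_nat x v) (mact a m), 0).
Proof.
rewrite /graded_bracket /= bracketJME !pieceE.
by rewrite ?(scaler0, subr0, oppr0, addr0, add0r, sub0r, scaleNr).
Qed.

Lemma graded_MJ i j x v a m : graded_bracket i j (vM v m) (xJ x a)
  = - (-1) ^+ (i * j) *: (0, tens (sl2_nat x v) (mact a m), 0).
Proof.
rewrite /graded_bracket /= bracketJME !pieceE.
by congr (_, _, _); rewrite /= ?(scaler0, subr0, oppr0, addr0, add0r, sub0r, scaleNr).
Qed.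

Lemma graded_MM i j v w m n : graded_bracket i j (vM v m) (vM w n)
  = (tens (odot v w) (star m n), 0, det2 v w *: partial i j m n).
Proof.
rewrite /graded_bracket /= bracketMME bracketMM_innerE !pieceE.
by rewrite ?(scaler0, subr0, oppr0, addr0, add0r, sub0r, scaleNr).
Qed.

Lemma graded_DJ i j (d : innder A) x a : graded_bracket i j (inD d) (xJ x a)
  = (tens x (dJ (innder_val d) a), 0, 0).
Proof.
rewrite /graded_bracket /= tens_dJE !pieceE.
by rewrite ?(scaler0, subr0, oppr0, addr0, add0r, sub0r, scaleNr).
Qed.

Lemma graded_JD i j (d : innder A) x a : graded_bracket i j (xJ x a) (inD d)
  = - (-1) ^+ (i * j) *: (tens x (dJ (innder_val d) a), 0, 0).
Proof.
rewrite /graded_bracket /= tens_dJE !pieceE.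
by congr (_, _, _); rewrite /= ?(scaler0, subr0, oppr0, addr0, add0r, sub0r, scaleNr).
Qed.

Lemma graded_DM i j (d : innder A) v m : graded_bracket i j (inD d) (vM v m)
  = (0, tens v (dM (innder_val d) m), 0).
Proof.
rewrite /graded_bracket /= tens_dME !pieceE.
by rewrite ?(scaler0, subr0, oppr0, addr0, add0r, sub0r, scaleNr).
Qed.

Lemma graded_MD i j (d : innder A) v m : graded_bracket i j (vM v m) (inD d)
  = - (-1) ^+ (i * j) *: (0, tens v (dM (innder_val d) m), 0).
Proof.
rewrite /graded_bracket /= tens_dME !pieceE.
by congr (_, _, _); rewrite /= ?(scaler0, subr0, oppr0, addr0, add0r, sub0r, scaleNr).
Qed.

Lemma graded_DD i j (d d' : innder A) : graded_bracket i j (inD d) (inD d')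
  = (0, 0, scomm (i * j) (innder_val d) (innder_val d')).
Proof.
rewrite /graded_bracket /= !pieceE.
by rewrite ?(scaler0, subr0, oppr0, addr0, add0r, sub0r, scaleNr).
Qed.

Lemma InnDer_graded i j u v : hdeg i u -> hdeg j v ->
  InnDer (graded_bracket i j u v).2.
Proof.
have [I0 Il] := InnDer_subspace A.
have lin (f : g -> ambient) : linear f -> forall k u, hdeg k u ->
    (forall t u, generator k t u -> @InnDer _ A (f u).2) -> @InnDer _ A (f u).2.
  move=> lf k u' hu' h; move: u' hu'; apply: hdeg_gJM_ind => [|p q Ip Iq|x a ha|w m hm|d Id hd].
  - by rewrite (linear_eq0 lf).
  - by rewrite (linear_add lf); apply: InnDerD.
  - by apply: (h 1%N); constructor.
  - by apply: (h 2%N); constructor.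
  - by apply: (h 0%N); constructor.
have [gr gl] := graded_bracket_bilinear i j.
move=> hu hv; apply: (lin (fun u => graded_bracket i j u v) (gl v) i u hu) => t {hu}u gu.
apply: (lin _ (gr u) j v hv) => t' {hv}v gv.
case: gu => [f If hf|x a ha|w m hm]; case: gv => [f' If' hf'|y b hb|z n hn];
  rewrite /inF ?(graded_JJ, graded_JM, graded_MJ, graded_MM, graded_DD,
    graded_DJ, graded_JD, graded_DM, graded_MD) //=.
- by rewrite !insubdIK //; apply: InnDer_scomm.
- exact: InnDerZ.
- exact: InnDerZ (InnDer_angle ha hb).
- exact: InnDerZ.
- exact: InnDerZ.
- exact: InnDerZ (InnDer_partial hm hn).
Qed.

(** Supersymmetry of partial_{m,n} in m and n: on J it comes from the
    anticommutativity of star, and on M from SJT4, which is what makes the term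
    det(v, w) partial_{m,n} of the bracket super-anticommutative. *)
Lemma partial_sym i j (m n : M) : hdeg i m -> hdeg j n ->
  partial j i n m = (-1) ^+ (i * j) *: partial i j m n.
Proof.
move=> hm hn; have s1 := superderivation_partial hm hn.
have s2 := superderivation_partial hn hm; apply: JM_linear_ext.
- exact: sder_linear s2.
- exact: linear_scale (sder_linear s1).
- move=> k a ha; rewrite -[RHS]/(_ *: partial _ _ _ _ (a, 0)).
  rewrite (sder_inl s1) (sder_inl s2).
  congr pair; last by rewrite /= scaler0.
  have ham := mact_even ha hm; have han := mact_even ha hn.
  rewrite /= !(dJ_partial _ _ _ _ ha) (star_anticomm han hm).
  by rewrite (star_anticomm hn ham); lmod.
- move=> k r hr; rewrite -[RHS]/(_ *: partial _ _ _ _ (0, r)).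
  rewrite (sder_inr s1) (sder_inr s2).
  congr pair; first by rewrite /= scaler0.
  by rewrite /= !dM_partial (SJT4 hm hn hr) (star_anticomm hn hm) !mactE; lmod.
Qed.

Lemma graded_anticomm i j u v : hdeg i u -> hdeg j v ->
  graded_bracket i j u v = - ((-1) ^+ (i * j) *: graded_bracket j i v u).
Proof.
pose P i j u v :=
  graded_bracket i j u v = - ((-1) ^+ (i * j) *: graded_bracket j i v u).
have gen : forall i j t t' u v, generator i t u -> generator j t' v -> P i j u v.
  apply: generator_swap; rewrite /P; last first.
    by move=> {P i j u v} i j u v hu hv E; rewrite E; lmod.
  move=> {P i j u v} i j t t' u v le gu gv; move: le.
  case: gu => [f If hf|x a ha|w m hm]; case: gv => [f' If' hf'|y b hb|z n hn] // _.
  - rewrite /inF !graded_DD; congr (_, _, _); rewrite /= ?scaler0 ?oppr0 //.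
    rewrite !insubdIK //.
    by rewrite /scomm; lmod.
  - by rewrite /inF graded_DJ graded_JD; apply: koszul_sign_cancel.
  - by rewrite /inF graded_DM graded_MD; apply: koszul_sign_cancel.
  - rewrite !graded_JJ (sl2_brC y x) (jmul_comm hb ha); congr (_, _, _) => /=.
    + by rewrite !(bilinearE (@tens_bilinear _ (sl2 F) J)); lmod.
    + by rewrite scaler0 oppr0.
    + rewrite /kappa (traceC y x).
      have -> : angle j i b a = - (-1) ^+ (i * j) *: angle i j a b.
        by apply/funext => z; apply: injective_projections => /=; lmod.
      by lmod.
  - by rewrite graded_JM graded_MJ; apply: koszul_sign_cancel.
  - rewrite !graded_MM (odotC z w) (star_anticomm hn hm); congr (_, _, _) => /=.
    + by rewrite !(bilinearE (@tens_bilinear _ (sl2 F) J)); lmod.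
    + by rewrite scaler0 oppr0.
    + by rewrite (det2C z w) (partial_sym hm hn); lmod.
move: u v => u v hu hv.
have [gr gl] := graded_bracket_bilinear i j.
have [gr' gl'] := graded_bracket_bilinear j i.
move: u hu; apply: hdeg_generator_ext => [|c p q|t u gu]; first exact: gl.
  by rewrite !graded_bracketE; lmod.
move: v hv; apply: hdeg_generator_ext => [|c p q|t' v gv]; first exact: gr.
  by rewrite !graded_bracketE; lmod.
exact: gen gu gv.
Qed.

(** Since graded_bracket has the right signs for homogeneous arguments only, it
    is applied to the homogeneous components. *)
Definition bracket_sum (u v : g) : ambient :=
  \sum_(i : bool) \sum_(j : bool) graded_bracket i j (hcomp i u) (hcomp j v).

Lemma bracket_sum_bilinear : bilinear_map bracket_sum.
Proof.
have lh i := @hcomp_linear _ g i.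
split=> [u|v] c p q; rewrite /bracket_sum scaler_sumr -big_split;
  apply: eq_bigr => i _; rewrite /= scaler_sumr -big_split;
  apply: eq_bigr => j _; rewrite lh.
  exact: (graded_bracket_bilinear i j).1.
exact: (graded_bracket_bilinear i j).2.
Qed.

Lemma bracket_sumE i j u v : hdeg i u -> hdeg j v ->
  bracket_sum u v = graded_bracket i j u v.
Proof.
move=> hu hv; rewrite /bracket_sum !big_bool.
rewrite !(hcomp_hdeg _ hu) !(hcomp_hdeg _ hv).
by case: (i) (j) => [] [] /=; rewrite !graded_bracketE ?addr0 ?add0r.
Qed.

Lemma InnDer_bracket_sum u v : InnDer (bracket_sum u v).2.
Proof.
rewrite /bracket_sum !big_bool; have hp i (z : g) := (hcompP i z).1.
have add (p q : ambient) : InnDer p.2 -> InnDer q.2 -> InnDer (p + q).2.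
  exact: InnDerD.
by apply: (add); apply: (add); apply: InnDer_graded; apply: hp.
Qed.

Lemma bracket_exists :
  exists br : g -> g -> g, forall u v, gval (br u v) = bracket_sum u v.
Proof.
exists (fun u v =>
  ((bracket_sum u v).1, insubd (0 : innder A) (bracket_sum u v).2)) => u v.
rewrite /gval /= insubdIK; last exact: InnDer_bracket_sum.
by case: (bracket_sum u v) => -[].
Qed.

Lemma gJM_bracket_exists : exists br, @gJM_bracket _ A br.
Proof.
have [br gval_br] := bracket_exists; exists br.
have gval_hdeg i j u v : hdeg i u -> hdeg j v ->
    gval (br u v) = graded_bracket i j u v.
  by move=> hu hv; rewrite gval_br; apply: bracket_sumE.
have E := linearE3 (@gval_linear _ A).
have br_bil : bilinear_map br.
  have [r l] := bracket_sum_bilinear.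
  by split=> [u|v] c p q; apply: gval_inj; rewrite !E !gval_br ?r // [LHS]l.
have Ebr := bilinearE br_bil; split.
- exact: br_bil.
- move=> i j u v hu hv; apply: gval_inj; rewrite !E.
  by rewrite (gval_hdeg _ _ _ _ hu hv) (gval_hdeg _ _ _ _ hv hu); apply: graded_anticomm.
- move=> i j d d' hd hd'.
  by rewrite (gval_hdeg _ _ _ _ (hdeg_inD hd) (hdeg_inD hd')) graded_DD.
- move=> d x a; move: d; apply: homogeneous_ext => [c p q|c p q|i d hd].
  + by rewrite inD_linear !Ebr.
  + by rewrite innder_val_linear (xJ_bilinear A).1.
  move: a; apply: homogeneous_ext => [c p q|c p q|j a ha].
  + by rewrite !xJE !Ebr.
  + rewrite -![(innder_val d (_, 0)).1]/(dJ (innder_val d) _).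
    rewrite (linear_dJ (InnDer_linear (InnDer_val d))).
    by rewrite (xJ_bilinear A).1.
  apply: gval_inj; rewrite (gval_hdeg _ _ _ _ (hdeg_inD hd) (hdeg_xJ x ha)).
  by rewrite graded_DJ.
- move=> d x a; move: d; apply: homogeneous_ext => [c p q|c p q|i d hd].
  + by rewrite inD_linear !Ebr.
  + by rewrite innder_val_linear (vM_bilinear A).1.
  move: a; apply: homogeneous_ext => [c p q|c p q|j a ha].
  + by rewrite !vME !Ebr.
  + rewrite -![(innder_val d (0, _)).2]/(dM (innder_val d) _).
    rewrite (linear_dM (InnDer_linear (InnDer_val d))).
    by rewrite (vM_bilinear A).1.
  apply: gval_inj; rewrite (gval_hdeg _ _ _ _ (hdeg_inD hd) (hdeg_vM x ha)).
  by rewrite graded_DM.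
- move=> i j x y a b ha hb.
  by rewrite (gval_hdeg _ _ _ _ (hdeg_xJ x ha) (hdeg_xJ y hb)) graded_JJ.
- move=> x v a m; move: a; apply: homogeneous_ext => [c p q|c p q|i a ha].
  + by rewrite !xJE !Ebr.
  + by rewrite !mactE !vME.
  move: m; apply: homogeneous_ext => [c p q|c p q|j m hm].
  + by rewrite !vME !Ebr.
  + by rewrite !mactE !vME.
  apply: gval_inj; rewrite (gval_hdeg _ _ _ _ (hdeg_xJ x ha) (hdeg_vM v hm)).
  by rewrite graded_JM.
- move=> i j v w m n hm hn.
  by rewrite (gval_hdeg _ _ _ _ (hdeg_vM v hm) (hdeg_vM w hn)) graded_MM.
Qed.

End BracketConstruction.

Unset Implicit Arguments.

Theorem theorem3p6 (R : realType) (A : ternary_superalgebra R[i]) :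
  exists2 br : gJM A -> gJM A -> gJM A,
    unique (@gJM_bracket _ A) br
    & short_sl2_lie_superalgebra br (@gJM_act _ A).
Proof.
have [br Hbr] := gJM_bracket_exists A.
exists br; last exact: br_short Hbr.
by split=> // br' Hbr'; apply: gJM_bracket_unique.
Qed.
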